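(* Fix an arbitrary environment $(\mathcal A,\mathcal O,\rho)$, a finite aleatoric state set $\mathcal S$, an initial aleatoric state $S_0\in\mathcal S$, an aleatoric state update function $f:\mathcal S\times\mathcal A\times\mathcal O\to\mathcal S$ and a reward function $r:\mathcal S\times\mathcal A\times\mathcal O\to[0,1]$. Let $\pi_{\rm agent}$ be the policy executed by the growing-horizon Q-learning algorithm (defined in the context). For $\tau\ge1$ let $\mathcal P_\tau=\{\pi\in\mathcal P:\tau_\pi\le\tau\}$ and $\mathrm{Regret}_{\mathcal P_\tau}(T)=\sup_{\pi\in\mathcal P_\tau}\mathbb E_{\pi_{\rm agent}}\big[\sum_{t=0}^{T-1}(\lambda_\pi-R_{t+1})\big]$. Then for all real $\tau\ge1$ and all integers $T\ge1$, $$\mathrm{Regret}_{\mathcal P_\tau}(T)\le\Big(120\sqrt{|\mathcal S||\mathcal A|\log(2T^2)}+5\tau\Big)T^{4/5}+3\,\overline{\Delta}_{\tau}T+\big(54|\mathcal S||\mathcal A|+18\log T\big)T^{1/5}+2\tau^5 .$$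
   Context: Environment, histories, policies. $\mathcal A,\mathcal O$ are nonempty finite sets. A history is a finite sequence $h=(a_0,o_1,\dots,a_{t-1},o_t)$ with $a_i\in\mathcal A$, $o_i\in\mathcal O$; $\mathcal H$ is the set of all histories, $H_0=()$ is the empty one, and $(h,a,o)$ denotes concatenation. The environment is given by a function $\rho$ with $\rho(\cdot|h,a)$ a probability distribution on $\mathcal O$ for each $(h,a)\in\mathcal H\times\mathcal A$ (held fixed; all expectations are conditional on the environment). A policy $\pi$ assigns to each $h\in\mathcal H$ a probability distribution $\pi(\cdot|h)$ on $\mathcal A$; $\mathcal P$ is the set of all policies. Under $\pi$, at each time $t=0,1,2,\dots$: $A_t\sim\pi(\cdot|H_t)$, $O_{t+1}\sim\rho(\cdot|H_t,A_t)$, $H_{t+1}=(H_t,A_t,O_{t+1})$; $\mathbb E_\pi$ is the corresponding expectation. Aleatoric states and rewards. $\phi:\mathcal H\to\mathcal S$ is defined by $\phi(H_0)=S_0$ and $\phi((h,a,o))=f(\phi(h),a,o)$. $S_t=\phi(H_t)$ and $R_{t+1}=r(S_t,A_t,O_{t+1})$. Average reward and averaging time. $\lambda_\pi=\liminf_{T\to\infty}\mathbb E_\pi[\frac1T\sum_{t=0}^{T-1}R_{t+1}]$, starting from the empty history. $\lambda_\pi(h,T)$ is the expected average reward over $T$ timesteps when interaction starts at history $h$ (instead of $H_0$) and actions are selected by $\pi$. The reward averaging time $\tau_\pi$ is the smallest $\tau\in[0,\infty)$ with $|\lambda_\pi(h,T)-\lambda_\pi|\le\tau/T$ for all $h\in\mathcal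 H$ and $T\ge1$ ($\tau_\pi=\infty$ if there is none). Optimal discounted values and distortion. For $\gamma\in[0,1)$, $V_\pi^\gamma(h)$ is the expected discounted sum of rewards (the reward realized after $k$ timesteps being weighted by $\gamma^k$) starting at history $h$ and following $\pi$; $Q_\pi^\gamma(h,a)=\bar r_{ah}+\gamma\sum_{o}\rho(o|h,a)V_\pi^\gamma((h,a,o))$ with $\bar r_{ah}=\sum_o\rho(o|h,a)r(\phi(h),a,o)$; $V_*^\gamma=\sup_\pi V_\pi^\gamma$, $Q_*^\gamma=\sup_\pi Q_\pi^\gamma$. For $\tau\ge1$, with $\gamma=1-1/\tau$, $$\Delta_\tau=\max_{(s,a)\in\mathcal S\times\mathcal A}\Big(\sup_{h:\phi(h)=s}Q_*^\gamma(h,a)-\inf_{h:\phi(h)=s}Q_*^\gamma(h,a)\Big)$$ (only $s$ in the range of $\phi$ matter), and $\overline\Delta_\tau=\sup_{\tau'\ge\tau}\Delta_{\tau'}$. Growing-horizon Q-learning. Change points: $T_0=1$, $T_k=20\cdot2^{k-1}$ for $k\ge1$. For $t\ge1$ let $k_t=\max\{k\ge0:T_k\le t\}$, and $k_0=0$. Initialize $s\leftarrow S_0$, $Q(\cdot,\cdot)\leftarrow1$, $N(\cdot,\cdot)\leftarrow0$ (tables on $\mathcal S\times\mathcal A$). For $t=1,2,\dots$: (1) $\tau\leftarrow T_{k_t}^{1/5}$, $\beta\leftarrow4T_{k_t}^{3/10}\sqrt{\log(2T_{k_t}^2)}$ (this algorithm variable $\tau$ is unrelated to the $\tau$ of the claim);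 (2) add $T_{k_t}^{1/5}-T_{k_{t-1}}^{1/5}$ to all entries of $Q$; multiply all entries of $N$ by $\mathbf 1(T_{k_t}=T_{k_{t-1}})$; (3) sample $a$ uniformly from $\arg\max_{a'}Q(s,a')$, execute $a$ (this is action $A_{t-1}$) and register the observation $o$ (this is $O_t$); (4) $N(s,a)\leftarrow N(s,a)+1$, $\alpha\leftarrow\frac{1+2\tau}{N(s,a)+2\tau}$, $s'\leftarrow f(s,a,o)$, $\gamma\leftarrow1-1/\tau$; (5) $Q(s,a)\leftarrow Q(s,a)+\alpha\big(r(s,a,o)+\gamma\max_{a'}Q(s',a')-Q(s,a)+\beta/\sqrt{N(s,a)}\big)$, then $Q(s,a)\leftarrow\min(Q(s,a),\tau)$, then $s\leftarrow s'$. *)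

(* Defs.v *)
From HB Require Import structures.
From mathcomp Require Import all_boot all_order all_algebra.
From mathcomp Require Import all_classical all_reals all_analysis.

Set Implicit Arguments.
Unset Strict Implicit.
Unset Printing Implicit Defensive.

Import Order.TTheory GRing.Theory Num.Theory.
Import numFieldNormedType.Exports.

Local Open Scope classical_set_scope.
Local Open Scope ring_scope.

Record fdist (R : realType) (X : finType) := FDist {
  fdist_fun :> X -> R;
  fdist_ge0 : forall x, 0 <= fdist_fun x;
  fdist_sum1 : \sum_(x : X) fdist_fun x = 1 }.

Section Uniform.
Variables (R : realType) (X : finType) (B : {set X}).
Hypothesis B_gt0 : (0 < #|B|)%N.

Definition unif_fun (x : X) : R := (x \in B)%:R / #|B|%:R.

Lemma unif_fun_ge0 (x : X) : 0 <= unif_fun x.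
Proof. by rewrite /unif_fun divr_ge0 // ler0n. Qed.

Lemma unif_fun_sum1 : \sum_(x : X) unif_fun x = 1.
Proof.
rewrite -mulr_suml -natr_sum -(big_mkcond (mem B) (fun=> 1%N)) sum1_card.
by rewrite divff // pnatr_eq0 -lt0n.
Qed.

Definition unif : fdist R X := FDist unif_fun_ge0 unif_fun_sum1.
End Uniform.

Section Environment.
Variables (R : realType) (A O : finType).

(* The pair (a_i, o_{i+1}) is the i-th entry of the sequence; [::] is H_0 and
   rcons h (a, o) is (h, a, o). *)
Definition history := seq (A * O).
Definition environment := history -> A -> fdist R O.
Definition policy := history -> fdist R A.

Section Interaction.
Variables (rho : environment) (pi : policy).

(* w lists the n action-observation pairs that follow the history h; its i-th
   pair is drawn at the history h ++ take i w. *)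
Definition traj_prob (h : history) (n : nat) (w : n.-tuple (A * O)) : R :=
  \prod_(i < n) (pi (h ++ take i w) (tnth w i).1 *
                 rho (h ++ take i w) (tnth w i).1 (tnth w i).2).

Definition expect (h : history) (n : nat) (F : n.-tuple (A * O) -> R) : R :=
  \sum_(w : n.-tuple (A * O)) traj_prob h w * F w.
End Interaction.
End Environment.

Section Agent.
Variables (R : realType) (A O S : finType).
Variables (S0 : S) (f : S -> A -> O -> S) (r : S -> A -> O -> R).

Definition phi (h : history A O) : S := foldl (fun s ao => f s ao.1 ao.2) S0 h.

Definition reward (h : history A O) (n : nat) (w : n.-tuple (A * O))
    (i : 'I_n) : R :=
  r (phi (h ++ take i w)) (tnth w i).1 (tnth w i).2.

Section Values.
Variable rho : environment R A O.

Definition avg_reward_from (pi : policy R A O) (h : history A O) (T : nat) : R :=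
  expect rho pi h (fun w : T.-tuple (A * O) => T%:R^-1 * \sum_(i < T) reward h w i).

(* The value 0 at T = 0 does not affect the limit inferior. *)
Definition avg_reward (pi : policy R A O) : R :=
  limn_inf (avg_reward_from pi [::]).

(* The set of admissible constants is closed, so that its infimum, when finite,
   is its smallest element; the infimum of the empty set is +oo. *)
Definition averaging_time (pi : policy R A O) : \bar R :=
  ereal_inf [set x%:E | x in [set x : R | 0 <= x /\
    forall (h : history A O) (T : nat), (1 <= T)%N ->
      `|avg_reward_from pi h T - avg_reward pi| <= x / T%:R]].

(* Rewards are bounded and 0 <= gamma < 1, so the expectation of the infinite
   discounted sum is the limit of the expectations of its partial sums. *)
Definition Vpi (gamma : R) (pi : policy R A O) (h : history A O) : R :=
  limn (fun n => expect rho pi h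
    (fun w : n.-tuple (A * O) => \sum_(k < n) gamma ^+ k * reward h w k)).

Definition mean_reward (a : A) (h : history A O) : R :=
  \sum_(o : O) rho h a o * r (phi h) a o.

Definition Qpi (gamma : R) (pi : policy R A O) (h : history A O) (a : A) : R :=
  mean_reward a h +
  gamma * \sum_(o : O) rho h a o * Vpi gamma pi (rcons h (a, o)).

Definition Qstar (gamma : R) (h : history A O) (a : A) : R :=
  sup [set Qpi gamma pi h a | pi in [set: policy R A O]].

Definition discount (tau : R) : R := 1 - 1 / tau.

(* The outer sup is a maximum: it is over a nonempty finite set. *)
Definition distortion (tau : R) : R :=
  sup [set sup [set Qstar (discount tau) h sa.2 | h in [set h | phi h = sa.1]] -
           inf [set Qstar (discount tau) h sa.2 | h in [set h | phi h = sa.1]]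
      | sa in [set sa : S * A | range phi sa.1]].

(* Extended-real: distortion tau' is only bounded by tau', so that its supremum
   may be infinite. *)
Definition sup_distortion (tau : R) : \bar R :=
  ereal_sup [set (distortion tau')%:E | tau' in [set tau' : R | tau <= tau']].

Definition policies_within (tau : R) : set (policy R A O) :=
  [set pi | (averaging_time pi <= tau%:E)%E].

(* The supremum over an empty reference class is -oo. *)
Definition regret (agent : policy R A O) (P : set (policy R A O)) (T : nat) :
    \bar R :=
  ereal_sup [set (expect rho agent [::] (fun w : T.-tuple (A * O) =>
    \sum_(t < T) (avg_reward pi - reward [::] w t)))%:E | pi in P].
End Values.

Definition change_point (k : nat) : nat :=
  if k is j.+1 then (20 * 2 ^ j)%N else 1%N.

(* change_point k <= t forces k <= t, so the bounded maximum is the maximum over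
   all k; at t = 0 no k qualifies and the value is 0. *)
Definition phase (t : nat) : nat :=
  (\max_(k < t.+1 | change_point k <= t) k)%N.

Definition phase_start (t : nat) : nat := change_point (phase t).

(* clock is the index t of the iteration about to be executed. *)
Record agent_state := AgentState {
  clock : nat;
  cur : S;
  Qtab : S -> A -> R;
  Ntab : S -> A -> nat }.

Definition init_state : agent_state :=
  AgentState 1 S0 (fun _ _ => 1) (fun _ _ => 0%N).

Definition horizon (t : nat) : R := (phase_start t)%:R `^ (1 / 5).

Definition bonus (t : nat) : R :=
  let T := (phase_start t)%:R in
  4 * T `^ (3 / 10) * Num.sqrt (ln (2 * T ^+ 2)).

(* Start-of-iteration rescaling, done before the action is chosen: the shift
   of Q and the reset of the counts are nontrivial only when a new
   phase starts. *)
Definition prepare (x : agent_state) : agent_state :=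
  let t := clock x in
  AgentState t (cur x)
    (fun s a => Qtab x s a + (horizon t - horizon t.-1))
    (fun s a => (Ntab x s a * (phase_start t == phase_start t.-1))%N).

(* x must already have been transformed by prepare; the inner sup is a maximum
   over the nonempty finite type A, taken in the table before the update. *)
Definition learn (x : agent_state) (a : A) (o : O) : agent_state :=
  let t := clock x in
  let s := cur x in
  let tau := horizon t in
  let beta := bonus t in
  let n := (Ntab x s a).+1 in
  let alpha := (1 + 2 * tau) / (n%:R + 2 * tau) in
  let s' := f s a o in
  let gamma := 1 - 1 / tau in
  let target := r s a o + gamma * sup (range (Qtab x s')) - Qtab x s a +
                beta / Num.sqrt n%:R in
  let q := Num.min (Qtab x s a + alpha * target) tau in
  AgentState t.+1 s'
    (fun s1 a1 => if (s1 == s) && (a1 == a) then q else Qtab x s1 a1)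
    (fun s1 a1 => if (s1 == s) && (a1 == a) then n else Ntab x s1 a1).

(* Apart from the random tie-breaking the algorithm is deterministic, so its
   state is a function of the past actions and observations. *)
Definition state_after (h : history A O) : agent_state :=
  foldl (fun x ao => learn (prepare x) ao.1 ao.2) init_state h.

Definition argmaxset (q : A -> R) : {set A} :=
  [set a | [forall a', q a' <= q a]]%SET.

Lemma argmaxset_gt0 (q : A -> R) : (0 < #|A|)%N -> (0 < #|argmaxset q|)%N.
Proof.
case/card_gt0P=> a0 _; apply/card_gt0P.
case: (@Order.TotalTheory.arg_maxP _ _ A a0 xpredT q isT) => a _ amax.
by exists a; rewrite inE; apply/forallP => a'; exact: amax.
Qed.

Definition agent_policy (A_gt0 : (0 < #|A|)%N) : policy R A O := fun h =>
  let x := prepare (state_after h) in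
  unif R (argmaxset_gt0 (Qtab x (cur x)) A_gt0).
End Agent.

(* Main.v *)
Require Import Defs.
From mathcomp Require Import all_boot all_order all_algebra.
From mathcomp Require Import all_classical all_reals all_analysis.
From mathcomp Require Import ring lra zify.
Set Implicit Arguments.
Unset Strict Implicit.
Unset Printing Implicit Defensive.
Import Order.TTheory GRing.Theory Num.Theory.
Import numFieldNormedType.Exports.
Local Open Scope classical_set_scope.
Local Open Scope ring_scope.

(** In a phase of horizon [H], that is with discount [g = 1 - 1/H], an update uses
    the rate [(1 + 2H) / (n + 2H)], for which the total weight of a sample in all
    later values of its cell is [1 + 1/(2H)], and [g (1 + 1/(2H)) <= 1].  Hence, on
    every path and up to bonuses, the greedy agent collects on average at least
    [c / H] per step as long as the values of the visited states stay above [c].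
    It remains to bound the tables from below by [lam H - O(tau + H Delta)], with
    [lam] the gain of the reference policy.

    The bound [Q >= Q_*] fails with non-negligible probability, since clipping at
    [H] discards the accumulated bonus.  The tables are compared instead with the
    optimal values for the horizon [3/5 H], raised by two thirds of the lower bound
    [lam * 3/5 H - tau] of these values.  This is a subsolution of the Bellman
    equation for the horizon [H], it leaves below [H] a margin proportional to the
    range of the values, and it only involves the distortion at [3/5 H >= tau].
    Once the bonus is below the margin, the noise is below the margin too; before
    that, the bonus alone keeps the table high.

    The noise of a cell is controlled by exponential supermartingales and Ville's
    inequality.  Tables are nonnegative, so a phase where this fails costs later
    phases at most a deficit equal to its own horizon, and so does the lack of
    control in the phases with [3/5 H < tau]; such a deficit [X] costs [X / H] per
    step. *)

(** * Hoeffding's lemma *)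

Section Hoeffding.
Variable R : realType.


Lemma is_derive_ge0_le (f df : R -> R) (x : R) : 0 <= x ->
  (forall y : R, is_derive y 1 f (df y)) -> (forall y, 0 <= y -> 0 <= df y) ->
  f 0 <= f x.
Proof.
move=> x0 fdf df0; rewrite -subr_ge0.
have cf : {within `[0, x], continuous f}.
  apply: continuous_subspaceT => y.
  by apply: differentiable_continuous; apply/derivable1_diffP; apply: ex_derive.
have [c cx ->] := MVT_segment x0 (fun y _ => fdf y) cf.
by rewrite mulr_ge0 ?subr0 // df0 // (itvP cx).
Qed.

(** The logarithm of the left side has derivative [s], the success probability of the exponentially
    tilted law, and second derivative [s (1 - s) <= 1/4]. Integrating twice from 0 gives the
    exponent. *)
Lemma bernoulli_mgf_pos (q u : R) : 0 <= q <= 1 -> 0 <= u ->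
  1 - q + q * expR u <= expR (q * u + u ^+ 2 / 8).
Proof.
move=> /andP[q0 q1] u0.
pose D (v : R) := 1 - q + q * expR v.
have D0 (v : R) : 0 < D v.
  rewrite /D; have := expR_gt0 v; case: (ltP 0 q) => [q_gt0 e0|q_le0 _].
    by apply: ltr_wpDl; [rewrite subr_ge0|rewrite mulr_gt0].
  by have -> : q = 0 by [lra|]; rewrite mul0r; lra.
have dD (v : R) : is_derive v 1 D (q * expR v).
  by rewrite /D; apply: is_derive_eq; rewrite /GRing.scale /=; ring.
pose s (v : R) := q * expR v / D v.
have ds (v : R) : is_derive v 1 s (s v * (1 - s v)).
  rewrite /s; have Dn0 : D v != 0 by rewrite gt_eqF.
  apply: is_derive_eq; rewrite /GRing.scale /=.
  by rewrite /D in Dn0 *; field.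
pose g (v : R) := v / 4 + q - s v.
have dg (v : R) : is_derive v 1 g (1 / 4 - s v * (1 - s v)).
  by rewrite /g; apply: is_derive_eq; rewrite /GRing.scale /=; field.
have g0 v : 0 <= v -> 0 <= g v.
  move=> v0; have -> : 0 = g 0.
    by rewrite /g /s /D expR0 mulr1 subrK divr1 mul0r add0r subrr.
  apply: (is_derive_ge0_le v0 dg) => w _.
  by have := sqr_ge0 (s w - 1 / 2); lra.
pose h (v : R) := v ^+ 2 / 8 + q * v - ln (D v).
have dh (v : R) : is_derive v 1 h (g v).
  have dl : is_derive v 1 (fun w => ln (D w)) (s v).
    have := @is_derive1_comp R (@ln R) D v _ _ (is_derive1_ln (D0 v)) (dD v).
    by rewrite /s mulrC.
  by rewrite /h; apply: is_derive_eq; rewrite /GRing.scale /= /g; field.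
have : 0 <= h u.
  have -> : 0 = h 0.
    by rewrite /h /D expR0 mulr1 subrK ln1 expr0n /= !mul0r mulr0 !addr0 subr0.
  exact: (is_derive_ge0_le u0 dh).
rewrite /h subr_ge0 => le_ln.
by rewrite -/(D u) -[leLHS]lnK ?posrE // ler_expR addrC.
Qed.

(** For [u < 0], factoring out [expR u] exchanges success and failure, that is, replaces [(q, u)] by
    [(1 - q, - u)]. *)
Lemma bernoulli_mgf (q u : R) : 0 <= q <= 1 ->
  1 - q + q * expR u <= expR (q * u + u ^+ 2 / 8).
Proof.
move=> q01; have [u0|u0] := leP 0 u; first exact: bernoulli_mgf_pos.
have q01' : 0 <= 1 - q <= 1 by lra.
have nu0 : 0 <= - u by rewrite oppr_ge0 ltW.
have := bernoulli_mgf_pos q01' nu0.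
rewrite -(ler_pM2l (expR_gt0 u)) -expRD mulrDr mulrCA -expRD subrr expR0.
by rewrite (_ : u + _ = q * u + u ^+ 2 / 8); [move=> ?|rewrite sqrrN; field]; lra.
Qed.

(** The tangent of the exponential at [y] lies below it at [a] and at [b], and the weights average
    these two points to [y]. *)
Lemma convex_chord (a b y : R) : a <= y <= b -> a < b ->
  expR y <= (b - y) / (b - a) * expR a + (y - a) / (b - a) * expR b.
Proof.
move=> /andP[ay yb] ab; have ab0 : 0 < b - a by rewrite subr_gt0.
have tangent z : expR y * (1 + (z - y)) <= expR z.
  rewrite -[in leRHS](subrK y z) expRD mulrC ler_wpM2r ?expR_ge0 //.
  exact: expR_ge1Dx.
have ca : 0 <= (b - y) / (b - a) by rewrite divr_ge0 ?subr_ge0 // ltW.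
have cb : 0 <= (y - a) / (b - a) by rewrite divr_ge0 ?subr_ge0 // ltW.
apply: le_trans (lerD (ler_wpM2l ca (tangent a)) (ler_wpM2l cb (tangent b))).
by rewrite le_eqVlt; apply/orP; left; apply/eqP; field; rewrite gt_eqF.
Qed.

(** By convexity the worst case has all its mass at the two ends of the range, with the same mean;
    this is [bernoulli_mgf] with success probability [q = (mu - lo) / w]. *)
Lemma hoeffding_lemma (O : finType) (p : fdist R O) (Y : O -> R) (lo w y : R) :
  0 < w -> (forall o, lo <= Y o <= lo + w) ->
  \sum_o p o * expR (y * (Y o - \sum_o' p o' * Y o')) <=
    expR (y ^+ 2 * w ^+ 2 / 8).
Proof.
move=> w0 Ylo; pose mu := \sum_o' p o' * Y o'; rewrite -/mu.
have p0 := fdist_ge0 p; have p1 := fdist_sum1 p.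
pose q := (mu - lo) / w.
have sumpD (F : O -> R) (c : R) : \sum_o p o * (F o + c) = \sum_o p o * F o + c.
  by under eq_bigr do rewrite mulrDr; rewrite big_split /= -mulr_suml p1 mul1r.
have q01 : 0 <= q <= 1.
  have mulo : lo <= mu <= lo + w.
    have cst (c : R) : c = \sum_o p o * c by rewrite -mulr_suml p1 mul1r.
    apply/andP; split.
      rewrite [leLHS]cst.
      by apply: ler_sum => o _; rewrite ler_wpM2l //; case/andP: (Ylo o).
    by rewrite [leRHS]cst; apply: ler_sum => o _;
      rewrite ler_wpM2l //; case/andP: (Ylo o).
  case/andP: mulo => mu1 mu2; rewrite /q ler_pdivrMr // mul1r lerBlDl mu2 andbT.
  by rewrite divr_ge0 ?subr_ge0 // ltW.
have pt o : expR (y * (Y o - mu)) <=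
    expR (- (q * (y * w))) * (1 - (Y o - lo) / w + (Y o - lo) / w * expR (y * w)).
  rewrite (_ : y * (Y o - mu) = - (q * (y * w)) + y * (Y o - lo)); last first.
    by rewrite /q; field; rewrite gt_eqF.
  rewrite expRD ler_wpM2l ?expR_ge0 //.
  (* The chord joins 0 and [y * w]: its orientation follows the sign of [y], and it degenerates at
     [y = 0]. *)
  have [->|y0] := eqVneq y 0; first by rewrite !mul0r expR0; lra.
  have /andP[Y1 Y2] := Ylo o.
  have [yp|yn] := ltP 0 y.
    have Yw : 0 <= y * (Y o - lo) <= y * w.
      by rewrite mulr_ge0 ?subr_ge0 // ?(ltW yp) //= ler_pM2l // lerBlDl.
    have := convex_chord Yw (mulr_gt0 yp w0).
    rewrite !subr0 expR0 mulr1.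
    rewrite (_ : (y * w - _) / _ = 1 - (Y o - lo) / w); last first.
      by field; rewrite y0 gt_eqF.
    rewrite (_ : y * (Y o - lo) / _ = (Y o - lo) / w) //.
    by field; rewrite y0 gt_eqF.
  have {y0 yn}yn : y < 0 by rewrite lt_neqAle y0.
  have Yw : y * w <= y * (Y o - lo) <= 0.
    by rewrite nmulr_rle0 // subr_ge0 Y1 andbT ler_nM2l // lerBlDl.
  have yw0 : y * w < 0 by rewrite nmulr_rlt0.
  have := convex_chord Yw yw0.
  rewrite expR0 mulr1.
  rewrite (_ : (0 - _) / _ = (Y o - lo) / w); last first.
    by field; rewrite ?mulf_neq0 ?(lt_eqF yn) ?(gt_eqF w0).
  rewrite (_ : (y * (Y o - lo) - _) / _ = 1 - (Y o - lo) / w); last first.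
    by field; rewrite ?mulf_neq0 ?(lt_eqF yn) ?(gt_eqF w0).
  by rewrite [X in _ <= X -> _]addrC.
apply: (@le_trans _ _ (expR (- (q * (y * w))) * (1 - q + q * expR (y * w)))).
  apply: le_trans (_ : \sum_o p o * (expR (- (q * (y * w))) *
      (1 - (Y o - lo) / w + (Y o - lo) / w * expR (y * w))) <= _).
    by apply: ler_sum => o _; rewrite ler_wpM2l.
  under eq_bigr do rewrite mulrCA; rewrite -mulr_sumr ler_wpM2l ?expR_ge0 //.
  rewrite le_eqVlt; apply/orP; left; apply/eqP.
  transitivity (\sum_o p o * (Y o * ((expR (y * w) - 1) / w) +
      (1 + lo / w - lo / w * expR (y * w)))).
    by apply: eq_bigr => o _; congr (_ * _); ring.
  rewrite sumpD; under eq_bigr do rewrite mulrA.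
  by rewrite -mulr_suml -/mu /q; ring.
have := bernoulli_mgf (y * w) q01.
rewrite -(ler_pM2l (expR_gt0 (- (q * (y * w))))) -expRD => /le_trans; apply.
by rewrite addrA addNr add0r exprMn.
Qed.
End Hoeffding.

(** * Expectations along trajectories *)

Section Expectation.
Variables (R : realType) (A O : finType).
Variables (rho : environment R A O) (pi : policy R A O).

Definition step_mean (h : history A O) (F : A * O -> R) : R :=
  \sum_ao pi h ao.1 * rho h ao.1 ao.2 * F ao.

Lemma step_meanE h (F : A -> O -> R) :
  step_mean h (fun ao => F ao.1 ao.2) =
  \sum_a pi h a * \sum_o rho h a o * F a o.
Proof.
rewrite /step_mean; under [RHS]eq_bigr do rewrite mulr_sumr.
by rewrite pair_bigA /=; apply: eq_bigr => ao _; rewrite mulrA.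
Qed.

Lemma step_mean_cst h (c : R) : step_mean h (fun=> c) = c.
Proof.
rewrite (step_meanE h (fun _ _ => c)).
under eq_bigr do rewrite -mulr_suml fdist_sum1 mul1r.
by rewrite -mulr_suml fdist_sum1 mul1r.
Qed.

Lemma step_mean_le h (F G : A * O -> R) :
  (forall ao, F ao <= G ao) -> step_mean h F <= step_mean h G.
Proof.
by move=> FG; apply: ler_sum => ao _; rewrite ler_wpM2l // mulr_ge0 // fdist_ge0.
Qed.

Lemma step_meanD h (F G : A * O -> R) :
  step_mean h (fun ao => F ao + G ao) = step_mean h F + step_mean h G.
Proof. by rewrite -big_split; apply: eq_bigr => ao _; rewrite mulrDr. Qed.

Lemma step_meanZ h (c : R) (F : A * O -> R) :
  step_mean h (fun ao => c * F ao) = c * step_mean h F.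
Proof. by rewrite mulr_sumr; apply: eq_bigr => ao _; rewrite mulrCA. Qed.

Lemma step_mean_sum h (I : Type) (s : seq I) (P : pred I) (F : I -> A * O -> R) :
  step_mean h (fun ao => \sum_(i <- s | P i) F i ao) =
  \sum_(i <- s | P i) step_mean h (F i).
Proof.
by rewrite /step_mean exchange_big; apply: eq_bigr => ao _; rewrite mulr_sumr.
Qed.

Lemma expect0 h (F : 0.-tuple (A * O) -> R) : expect rho pi h F = F [tuple].
Proof.
rewrite /expect (big_pred1 [tuple]); last by move=> w; apply/esym/eqP; exact: tuple0.
by rewrite /traj_prob big_ord0 mul1r.
Qed.

Lemma expectS h n (F : n.+1.-tuple (A * O) -> R) :
  expect rho pi h F =
  step_mean h (fun ao => expect rho pi (rcons h ao)
    (fun w : n.-tuple (A * O) => F [tuple of ao :: w])).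
Proof.
pose g (p : (A * O) * n.-tuple (A * O)) := [tuple of p.1 :: p.2].
rewrite /expect /step_mean (reindex g) /=; last first.
  exists (fun w : n.+1.-tuple (A * O) => (thead w, [tuple of behead w])).
    by move=> [ao w] _; congr pair; apply: val_inj.
  by move=> w _; rewrite /g [RHS]tuple_eta.
under [RHS]eq_bigr do rewrite mulr_sumr.
rewrite pair_bigA /=; apply: eq_bigr => -[ao w] _ /=; rewrite mulrA; congr (_ * _).
rewrite /traj_prob big_ord_recl /= cats0; congr (_ * _).
apply: eq_bigr => i _; rewrite tnthS /= cat_rcons //.
Qed.

(** Restricting the comparison to trajectories of positive probability lets pathwise bounds use that
    the agent is greedy. *)
Lemma expect_le h n (F G : n.-tuple (A * O) -> R) :
  (forall w, traj_prob rho pi h w != 0 -> F w <= G w) ->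
  expect rho pi h F <= expect rho pi h G.
Proof.
move=> FG; apply: ler_sum => w _; have [->|w0] := eqVneq (traj_prob rho pi h w) 0.
  by rewrite !mul0r.
rewrite ler_wpM2l ?FG //; apply: prodr_ge0 => i _.
by rewrite mulr_ge0 // fdist_ge0.
Qed.

Lemma expectD h n (F G : n.-tuple (A * O) -> R) :
  expect rho pi h (fun w => F w + G w) = expect rho pi h F + expect rho pi h G.
Proof. by rewrite -big_split; apply: eq_bigr => w _; rewrite mulrDr. Qed.

Lemma expectZ h n (c : R) (F : n.-tuple (A * O) -> R) :
  expect rho pi h (fun w => c * F w) = c * expect rho pi h F.
Proof. by rewrite mulr_sumr; apply: eq_bigr => w _; rewrite mulrCA. Qed.

Lemma expect_sum h n (I : Type) (s : seq I) (P : pred I)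
    (F : I -> n.-tuple (A * O) -> R) :
  expect rho pi h (fun w => \sum_(i <- s | P i) F i w) =
  \sum_(i <- s | P i) expect rho pi h (F i).
Proof.
by rewrite /expect exchange_big; apply: eq_bigr => w _; rewrite mulr_sumr.
Qed.

Lemma expect_cst h n (c : R) : expect rho pi h (fun _ : n.-tuple (A * O) => c) = c.
Proof.
elim: n h => [|n IHn] h; first by rewrite expect0.
rewrite expectS -[RHS](step_mean_cst h c).
by apply: eq_bigr => ao _; rewrite IHn.
Qed.

(** Induction on the number of steps: if [M h >= 1] the bound is trivial; otherwise the level is
    reached after the first step, and the supermartingale property averages the induction
    hypotheses. *)
Lemma ville_inequality (M : history A O -> R) h n :
  (forall h, 0 <= M h) -> (forall h, step_mean h (fun ao => M (rcons h ao)) <= M h) ->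
  expect rho pi h
    (fun w : n.-tuple (A * O) => [exists i : 'I_n.+1, 1 <= M (h ++ take i w)]%:R)
  <= M h.
Proof.
move=> M0 Msup; elim: n h => [|n IHn] h.
  by rewrite expect0; case: existsP => // -[[[|i] lti]] /=; rewrite cats0.
have [M1|M1] := leP 1 (M h).
  apply: le_trans M1; rewrite -[leRHS](expect_cst h n.+1); apply: expect_le => w _.
  by rewrite lern1 leq_b1.
rewrite expectS; apply: le_trans (Msup h); apply: step_mean_le => ao.
apply: le_trans (IHn _); apply: expect_le => w _.
rewrite ler_nat; case: existsP => //= -[[[|i] lti]] /=.
  by rewrite cats0 leNgt M1.
move=> Mi; suff -> : [exists i : 'I_n.+1, 1 <= M (rcons h ao ++ take i w)] by [].
by apply/existsP; exists (Ordinal (lti : i < n.+1)%N); rewrite cat_rcons.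
Qed.
End Expectation.

(** * Values of a policy *)

Section RealSequences.
Variable R : realType.

Lemma sum_expr_eq (g : R) n : (1 - g) * \sum_(k < n) g ^+ k = 1 - g ^+ n.
Proof.
elim: n => [|n IHn]; first by rewrite big_ord0 mulr0 expr0 subrr.
by rewrite big_ord_recr /= mulrDr IHn exprS; ring.
Qed.

(* By Abel summation, as the weights [g ^+ k] decrease. *)
Lemma discounted_sum_ge (g b : R) (x : nat -> R) n : 0 <= g <= 1 ->
  (forall m, - b <= \sum_(k < m) x k) -> - b <= \sum_(k < n) g ^+ k * x k.
Proof.
move=> /andP[g0 g1] xb.
have gn0 m : 0 <= g ^+ m by rewrite exprn_ge0.
have abel m : - b * (1 - g ^+ m) <=
    \sum_(k < m) g ^+ k * x k - g ^+ m * \sum_(k < m) x k.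
  elim: m => [|m IHm]; first by rewrite !big_ord0 expr0 subrr !mulr0 subrr.
  rewrite !big_ord_recr /=; have := xb m.+1; rewrite big_ord_recr /= => xbm.
  have : 0 <= (g ^+ m - g ^+ m.+1) * (\sum_(k < m) x k + x m + b).
    rewrite mulr_ge0 //; last by lra.
    by rewrite subr_ge0 exprS ler_piMl.
  move: IHm; lra.
have := abel n; have := ler_wpM2l (gn0 n) (xb n); lra.
Qed.

Lemma le_limn_geometric (a b g l : R) : 0 <= g -> g < 1 ->
  (forall n, a * (1 - g ^+ n) - b <= l) -> a - b <= l.
Proof.
move=> g0 g1 al.
have cg : (fun n => a * (1 - g ^+ n) - b) @ \oo --> a * (1 - 0) - b.
  apply: cvgB; last exact: cvg_cst.
  apply: cvgM; first exact: cvg_cst.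
  apply: cvgB; first exact: cvg_cst.
  by apply: cvg_expr; rewrite ger0_norm.
rewrite -[a]mulr1 -[X in a * X]subr0; apply: (cvgr_to_le cg).
by apply: nearW => n; exact: al.
Qed.
End RealSequences.

Section MaxTable.
Variables (R : realType) (A : finType).

Lemma has_ubound_range (q : A -> R) : has_ubound (range q).
Proof.
exists (\sum_a `|q a|) => _ [a _ <-]; rewrite (bigD1 a) //=.
by rewrite (le_trans (ler_norm _)) // lerDl sumr_ge0.
Qed.

Lemma le_sup_range (q : A -> R) a : q a <= sup (range q).
Proof. by apply: ub_le_sup; [exact: has_ubound_range|exists a]. Qed.

Lemma sup_range_le (q : A -> R) c : (0 < #|A|)%N ->
  (forall a, q a <= c) -> sup (range q) <= c.
Proof.
move=> /card_gt0P[a0 _] qc; apply: ge_sup; first by exists (q a0), a0.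
by move=> _ [a _ <-].
Qed.

Lemma sup_range_argmax (q : A -> R) a : a \in argmaxset q -> sup (range q) = q a.
Proof.
rewrite inE => /forallP qa; apply/eqP; rewrite eq_le le_sup_range andbT.
by apply: sup_range_le => //; apply/card_gt0P; exists a.
Qed.
End MaxTable.

Section Values.
Variables (R : realType) (A O S : finType).
Variables (S0 : S) (f : S -> A -> O -> S) (r : S -> A -> O -> R).
Hypothesis r01 : forall s a o, 0 <= r s a o <= 1.
Variable rho : environment R A O.
Local Notation phi := (phi S0 f).
Local Notation Vpi := (Vpi S0 f r rho).
Local Notation Qpi := (Qpi S0 f r rho).
Local Notation Qstar := (Qstar S0 f r rho).
Local Notation rew h ao := (r (phi h) ao.1 ao.2).

Lemma phi_rcons h ao : phi (rcons h ao) = f (phi h) ao.1 ao.2.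
Proof. by rewrite /Defs.phi foldl_rcons. Qed.

(** Recursion on the first step matches [expectS] and reduces expectations over tuples to real
    sequences. *)
Fixpoint mean_reward_at (pi : policy R A O) (k : nat) (h : history A O) : R :=
  if k is j.+1 then step_mean rho pi h (fun ao => mean_reward_at pi j (rcons h ao))
  else step_mean rho pi h (fun ao => rew h ao).

Lemma expect_discounted (pi : policy R A O) (g : R) n h :
  expect rho pi h (fun w : n.-tuple (A * O) =>
    \sum_(k < n) g ^+ k * reward S0 f r h w k)
  = \sum_(k < n) g ^+ k * mean_reward_at pi k h.
Proof.
elim: n h => [|n IHn] h; first by rewrite expect0 !big_ord0.
rewrite expectS big_ord_recl expr0 mul1r [mean_reward_at _ _ _]/=.
under [X in _ + X]eq_bigr do rewrite lift0 exprS -mulrA.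
rewrite -mulr_sumr.
under [X in _ + _ * X]eq_bigr do rewrite -step_meanZ.
rewrite -step_mean_sum -step_meanZ -step_meanD; apply: eq_bigr => ao _.
congr (_ * _); rewrite -IHn -expectZ -[rew h ao](expect_cst rho pi (rcons h ao) n).
rewrite -expectD; congr expect; apply/funext => w.
rewrite big_ord_recl expr0 mul1r /reward /= cats0; congr (_ + _).
rewrite mulr_sumr; apply: eq_bigr => i _.
by rewrite /bump leq0n add1n exprS -mulrA tnthS /= cat_rcons.
Qed.

Definition disc_value (g : R) (pi : policy R A O) n h :=
  \sum_(k < n) g ^+ k * mean_reward_at pi k h.

Lemma disc_valueS g pi n h : disc_value g pi n.+1 h =
  step_mean rho pi h (fun ao => rew h ao + g * disc_value g pi n (rcons h ao)).
Proof.
rewrite /disc_value big_ord_recl expr0 mul1r step_meanD; congr (_ + _).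
rewrite step_meanZ step_mean_sum mulr_sumr; apply: eq_bigr => i _.
by rewrite lift0 exprS -mulrA step_meanZ.
Qed.

Lemma mean_reward_at_01 pi k h : 0 <= mean_reward_at pi k h <= 1.
Proof.
elim: k h => [|k IHk] h /=; apply/andP; split.
- by rewrite -(step_mean_cst rho pi h 0); apply: step_mean_le => ao;
    case/andP: (r01 (phi h) ao.1 ao.2).
- by rewrite -[leRHS](step_mean_cst rho pi h); apply: step_mean_le => ao;
    case/andP: (r01 (phi h) ao.1 ao.2).
- by rewrite -(step_mean_cst rho pi h 0); apply: step_mean_le => ao;
    case/andP: (IHk (rcons h ao)).
- by rewrite -[leRHS](step_mean_cst rho pi h); apply: step_mean_le => ao;
    case/andP: (IHk (rcons h ao)).
Qed.

Section Policy.
Variable pi : policy R A O.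

Lemma mean_reward_at_ge0 k h : 0 <= mean_reward_at pi k h.
Proof. by case/andP: (mean_reward_at_01 pi k h). Qed.

Lemma mean_reward_at_le1 k h : mean_reward_at pi k h <= 1.
Proof. by case/andP: (mean_reward_at_01 pi k h). Qed.

Section Discount.
Variable g : R.
Hypothesis g01 : 0 <= g < 1.
Let g0 : 0 <= g. Proof. by case/andP: g01. Qed.
Let g1 : g < 1. Proof. by case/andP: g01. Qed.
Let g1' : 0 < 1 - g. Proof. by rewrite subr_gt0. Qed.

Lemma disc_value_le n h : disc_value g pi n h <= (1 - g)^-1.
Proof.
rewrite -div1r ler_pdivlMr // mulrC.
apply: (@le_trans _ _ ((1 - g) * \sum_(k < n) g ^+ k)).
  rewrite ler_pM2l //; apply: ler_sum => i _.
  by rewrite ler_piMr ?exprn_ge0 // mean_reward_at_le1.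
by rewrite sum_expr_eq gerBl exprn_ge0.
Qed.

Lemma disc_value_nd h : nondecreasing_seq (fun n => disc_value g pi n h).
Proof.
apply/nondecreasing_seqP => n; rewrite /disc_value big_ord_recr /= lerDl.
by rewrite mulr_ge0 ?exprn_ge0 ?mean_reward_at_ge0.
Qed.

Lemma disc_value_cvg h : cvgn (fun n => disc_value g pi n h).
Proof.
apply: nondecreasing_is_cvgn; first exact: disc_value_nd.
by exists (1 - g)^-1 => _ [n _ <-]; exact: disc_value_le.
Qed.

Lemma VpiE h : Vpi g pi h = limn (fun n => disc_value g pi n h).
Proof.
rewrite /Defs.Vpi; set u := (X in limn X); suff -> : u = disc_value g pi ^~ h by [].
by apply/funext => n; rewrite /u expect_discounted.
Qed.

Lemma disc_value_le_Vpi n h : disc_value g pi n h <= Vpi g pi h.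
Proof.
by rewrite VpiE; apply: nondecreasing_cvgn_le; [exact: disc_value_nd|exact: disc_value_cvg].
Qed.

Lemma Vpi_le_bound h c : (forall n, disc_value g pi n h <= c) -> Vpi g pi h <= c.
Proof.
by move=> dc; rewrite VpiE; apply: limr_le; [exact: disc_value_cvg|exact: nearW].
Qed.

Lemma Vpi_ge0 h : 0 <= Vpi g pi h.
Proof. by apply: le_trans (disc_value_le_Vpi 0%N h); rewrite /disc_value big_ord0. Qed.

Lemma Vpi_le h : Vpi g pi h <= (1 - g)^-1.
Proof. by apply: Vpi_le_bound => n; exact: disc_value_le. Qed.

(** One half of the Bellman equation: a finite-horizon value satisfies the one-step recursion, and
    the value of the remaining steps is at most its limit. *)
Lemma Vpi_le_Qpi h c : (forall a, Qpi g pi h a <= c) -> Vpi g pi h <= c.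
Proof.
move=> Qc.
apply: (@le_trans _ _ (\sum_a pi h a * Qpi g pi h a)); last first.
  rewrite -[leRHS]mul1r -(fdist_sum1 (pi h)) mulr_suml.
  by apply: ler_sum => a _; rewrite ler_wpM2l // fdist_ge0.
rewrite (_ : \sum_a _ =
    step_mean rho pi h (fun ao => rew h ao + g * Vpi g pi (rcons h ao))); last first.
  transitivity (step_mean rho pi h
    (fun ao => rew h ao + g * Vpi g pi (rcons h (ao.1, ao.2)))); last first.
    by apply: eq_bigr => -[a o] _.
  apply/esym; apply: etrans (step_meanE rho pi h
    (fun a o => r (phi h) a o + g * Vpi g pi (rcons h (a, o)))) _.
  apply: eq_bigr => a _; congr (_ * _).
  rewrite /Defs.Qpi /mean_reward mulr_sumr -big_split /=.
  by apply: eq_bigr => o _; rewrite mulrDr mulrCA.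
apply: Vpi_le_bound => -[|n].
  rewrite /disc_value big_ord0 -(step_mean_cst rho pi h 0).
  apply: step_mean_le => ao; rewrite addr_ge0 ?mulr_ge0 ?Vpi_ge0 //.
  by case/andP: (r01 (phi h) ao.1 ao.2).
rewrite disc_valueS; apply: step_mean_le => ao.
by rewrite lerD2l ler_wpM2l // disc_value_le_Vpi.
Qed.

Lemma Qpi_ge0 h a : 0 <= Qpi g pi h a.
Proof.
rewrite addr_ge0 ?mulr_ge0 // sumr_ge0 // => o _; rewrite mulr_ge0 ?fdist_ge0 ?Vpi_ge0 //.
by case/andP: (r01 (phi h) a o).
Qed.

Lemma Qpi_le h a : Qpi g pi h a <= (1 - g)^-1.
Proof.
apply: (@le_trans _ _ (1 + g * (1 - g)^-1)); last first.
  by rewrite le_eqVlt; apply/orP; left; apply/eqP; field; rewrite gt_eqF.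
have cst c : c = \sum_o rho h a o * c by rewrite -mulr_suml fdist_sum1 mul1r.
apply: lerD; last rewrite ler_wpM2l //.
  rewrite [leRHS]cst; apply: ler_sum => o _; rewrite ler_wpM2l ?fdist_ge0 //.
  by case/andP: (r01 (phi h) a o).
rewrite [leRHS]cst; apply: ler_sum => o _; rewrite ler_wpM2l ?fdist_ge0 //.
exact: Vpi_le.
Qed.
End Discount.

(** The weights [g ^+ k - g' ^+ k] are nonnegative and multiply mean rewards at most 1, so the
    values differ by at most the difference of the total weights. *)
Lemma Vpi_discount_le g g' h : 0 <= g' -> g' <= g -> g < 1 ->
  Vpi g pi h <= Vpi g' pi h + ((1 - g)^-1 - (1 - g')^-1).
Proof.
move=> g'0 g'g g1; have g0 := le_trans g'0 g'g; have g'1 := le_lt_trans g'g g1.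
have g01 : 0 <= g < 1 by rewrite g0.
have g'01 : 0 <= g' < 1 by rewrite g'0.
apply: Vpi_le_bound => // n; apply: le_trans (lerD (disc_value_le_Vpi g'01 n h) (lexx _)).
rewrite -lerBlDl -sumrB.
apply: (@le_trans _ _ (\sum_(k < n) g ^+ k - \sum_(k < n) g' ^+ k)).
  rewrite -sumrB; apply: ler_sum => k _; rewrite -mulrBl ler_piMr ?mean_reward_at_le1 //.
  by rewrite subr_ge0 lerXn2r ?nnegrE.
have geo (x : R) : 0 <= x -> x < 1 -> \sum_(k < n) x ^+ k = (1 - x)^-1 - x ^+ n * (1 - x)^-1.
  move=> x0 x1; have x1' : 1 - x != 0 by rewrite subr_eq0 gt_eqF.
  by apply: (mulfI x1'); rewrite /= sum_expr_eq mulrBr mulrCA mulfV // mulr1.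
rewrite !geo //.
have : g' ^+ n * (1 - g')^-1 <= g ^+ n * (1 - g)^-1.
  rewrite ler_pM ?exprn_ge0 ?invr_ge0 ?subr_ge0 ?(ltW g'1) //.
    by rewrite lerXn2r ?nnegrE.
  by rewrite lef_pV2 ?posrE ?subr_gt0 // lerD2l lerN2.
lra.
Qed.

Lemma Qpi_discount_le g g' h a : 0 <= g' -> g' <= g -> g < 1 ->
  Qpi g pi h a <= Qpi g' pi h a + ((1 - g)^-1 - (1 - g')^-1).
Proof.
move=> g'0 g'g g1; have g0 := le_trans g'0 g'g; have g'1 := le_lt_trans g'g g1.
have g'01 : 0 <= g' < 1 by rewrite g'0.
rewrite /Defs.Qpi -!addrA lerD2l.
have cst c : c = \sum_o rho h a o * c by rewrite -mulr_suml fdist_sum1 mul1r.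
set d := (1 - g)^-1 - _; set S1 := \sum_o _; set S2 := \sum_o _.
have S12 : S1 <= S2 + d.
  rewrite [d]cst -big_split /=; apply: ler_sum => o _.
  by rewrite -mulrDr ler_wpM2l ?fdist_ge0 // Vpi_discount_le.
have S2le : S2 <= (1 - g')^-1.
  rewrite [leRHS]cst; apply: ler_sum => o _; rewrite ler_wpM2l ?fdist_ge0 //.
  exact: Vpi_le.
have e (x : R) : x < 1 -> x * (1 - x)^-1 = (1 - x)^-1 - 1.
  by move=> x1; field; rewrite subr_eq0 gt_eqF.
have := ler_wpM2l g0 S12.
have : (g - g') * S2 <= (g - g') * (1 - g')^-1 by rewrite ler_wpM2l ?subr_ge0.
have := e _ g1; have := e _ g'1; rewrite /d; lra.
Qed.

Section AveragingTime.
Variable tau : R.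
Hypothesis pi_tau : policies_within S0 f r rho tau pi.
Local Notation lam := (avg_reward S0 f r rho pi).

Lemma avg_reward_fromE h T :
  avg_reward_from S0 f r rho pi h T = T%:R^-1 * \sum_(k < T) mean_reward_at pi k h.
Proof.
rewrite /avg_reward_from expectZ; congr (_ * _).
have := expect_discounted pi 1 T h.
under eq_bigr do rewrite expr1n mul1r; move=> <-.
by congr expect; apply/funext => w; apply: eq_bigr => k _; rewrite expr1n mul1r.
Qed.

Lemma avg_reward_from_close h T : (1 <= T)%N ->
  `|avg_reward_from S0 f r rho pi h T - lam| <= tau / T%:R.
Proof.
move=> T1; have T0 : 0 < T%:R :> R by rewrite ltr0n.
(* The averaging time is an infimum, so an admissible constant is taken within [e * T] of it. *)
apply/ler_addgt0Pr => e e0.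
have : (averaging_time S0 f r rho pi < (tau + e * T%:R)%:E)%E.
  by apply: le_lt_trans pi_tau _; rewrite lte_fin ltrDl mulr_gt0.
case/ereal_inf_lt => _ [x [x0 xP] <-]; rewrite lte_fin => xtau.
apply: le_trans (xP h T T1) _; rewrite ler_pdivrMr // mulrDl divfK ?gt_eqF //.
exact: ltW.
Qed.

(** The maximum with 0 covers [T = 0], where the sum is empty. *)
Lemma sum_mean_reward_close h T :
  `|\sum_(k < T) mean_reward_at pi k h - T%:R * lam| <= Num.max 0 tau.
Proof.
case: T => [|T]; first by rewrite big_ord0 mul0r subrr normr0 le_max lexx.
have T0 : 0 < T.+1%:R :> R by rewrite ltr0n.
have := avg_reward_from_close h (isT : (1 <= T.+1)%N); rewrite avg_reward_fromE ler_pdivlMr //.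
rewrite -{2}(gtr0_norm T0) -normrM mulrBl mulrAC mulVf ?gt_eqF // mul1r (mulrC lam).
by move=> /le_trans; apply; rewrite le_max lexx orbT.
Qed.

(** [T * lam] stays within a constant of a sum that lies between 0 and [T], and a linear function of
    [T] bounded above has slope at most 0. *)
Lemma avg_reward_01 : 0 <= lam <= 1.
Proof.
have bnd (c : R) : (forall T : nat, T%:R * c <= Num.max 0 tau) -> c <= 0.
  move=> Tc; rewrite leNgt; apply/negP => c0.
  have := Tc (Num.truncn (Num.max 0 tau / c)).+1.
  rewrite leNgt => /negP; apply; rewrite -ltr_pdivrMr //.
  exact: truncnS_gt.
apply/andP; split.
  rewrite -oppr_le0; apply: bnd => T; rewrite mulrN.
  have := sum_mean_reward_close [::] T; rewrite ler_norml => /andP[_].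
  have : 0 <= \sum_(k < T) mean_reward_at pi k [::].
    by apply: sumr_ge0 => k _; exact: mean_reward_at_ge0.
  lra.
rewrite -subr_le0; apply: bnd => T; rewrite mulrBr mulr1.
have := sum_mean_reward_close [::] T; rewrite ler_norml => /andP[+ _].
have : \sum_(k < T) mean_reward_at pi k [::] <= T%:R.
  apply: (@le_trans _ _ (\sum_(k < T) 1)); last by rewrite sumr_const card_ord.
  by apply: ler_sum => k _; exact: mean_reward_at_le1.
lra.
Qed.

(** The partial sums of the deviations from [lam] are at least [- tau], hence so are their
    discounted sums, while the constant [lam] contributes a geometric series. *)
Lemma Vpi_ge_avg g h : 0 <= tau -> 0 <= g < 1 -> lam * (1 - g)^-1 - tau <= Vpi g pi h.
Proof.
move=> tau0 g01; have /andP[g0 g1] := g01; have g1' : 0 < 1 - g by rewrite subr_gt0.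
apply: (le_limn_geometric (g := g)) => // n.
apply: le_trans (disc_value_le_Vpi g01 n h).
have := @discounted_sum_ge R g tau (fun k => mean_reward_at pi k h - lam) n.
rewrite g0 (ltW g1) => /(_ isT).
have -> : \sum_(k < n) g ^+ k * (mean_reward_at pi k h - lam) =
    disc_value g pi n h - lam * \sum_(k < n) g ^+ k.
  by rewrite mulr_sumr -sumrB; apply: eq_bigr => k _; rewrite mulrBr (mulrC lam).
have -> : \sum_(k < n) g ^+ k = (1 - g)^-1 * (1 - g ^+ n).
  by rewrite -sum_expr_eq mulKf ?gt_eqF.
suff xb m : - tau <= \sum_(k < m) (mean_reward_at pi k h - lam).
  by move=> /(_ xb); lra.
have := sum_mean_reward_close h m; rewrite ler_norml => /andP[+ _].
rewrite (max_idPr tau0) sumrB sumr_const card_ord mulr_natl.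
lra.
Qed.
End AveragingTime.
End Policy.
End Values.

(** * Optimal values *)

Section OptimalValues.
Variables (R : realType) (A O S : finType) (A_gt0 : (0 < #|A|)%N).
Variables (S0 : S) (f : S -> A -> O -> S) (r : S -> A -> O -> R).
Hypothesis r01 : forall s a o, 0 <= r s a o <= 1.
Variable rho : environment R A O.
Variable pi : policy R A O.
Local Notation phi := (phi S0 f).
Local Notation Vpi := (Vpi S0 f r rho).
Local Notation Qpi := (Qpi S0 f r rho).
Local Notation Qstar := (Qstar S0 f r rho).

Definition opt_value (g : R) (h : history A O) : R := sup (range (Qstar g h)).

Section Discount.
Variable g : R.
Hypothesis g01 : 0 <= g < 1.

Lemma Qpi_le_Qstar pi' h a : Qpi g pi' h a <= Qstar g h a.
Proof.
apply: ub_le_sup; last by exists pi'.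
by exists (1 - g)^-1 => _ [p _ <-]; exact: Qpi_le.
Qed.

Lemma Qstar_le_bound h a c : (forall pi', Qpi g pi' h a <= c) -> Qstar g h a <= c.
Proof.
by move=> Qc; apply: ge_sup; [exists (Qpi g pi h a), pi|move=> _ [p _ <-]].
Qed.

Lemma Qstar_ge0 h a : 0 <= Qstar g h a.
Proof. exact: le_trans (Qpi_ge0 S0 f r01 rho pi g01 h a) (Qpi_le_Qstar pi h a). Qed.

Lemma Qstar_le h a : Qstar g h a <= (1 - g)^-1.
Proof. by apply: Qstar_le_bound => p; exact: Qpi_le. Qed.

Lemma Qstar_le_opt_value h a : Qstar g h a <= opt_value g h.
Proof. exact: le_sup_range. Qed.

Lemma opt_value_le h : opt_value g h <= (1 - g)^-1.
Proof. by apply: sup_range_le => // a; exact: Qstar_le. Qed.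

Lemma Vpi_le_opt_value pi' h : Vpi g pi' h <= opt_value g h.
Proof.
apply: Vpi_le_Qpi => // a.
exact: le_trans (Qpi_le_Qstar pi' h a) (Qstar_le_opt_value h a).
Qed.

Lemma opt_value_ge0 h : 0 <= opt_value g h.
Proof. exact: le_trans (Vpi_ge0 S0 f r01 rho pi g01 h) (Vpi_le_opt_value pi h). Qed.

Lemma Qstar_bellman_le h a :
  Qstar g h a <=
  \sum_o rho h a o * (r (phi h) a o + g * opt_value g (rcons h (a, o))).
Proof.
apply: Qstar_le_bound => p; rewrite /Defs.Qpi /mean_reward mulr_sumr -big_split /=.
apply: ler_sum => o _; rewrite mulrDr lerD2l mulrCA.
case/andP: g01 => g0 _; rewrite ler_wpM2l ?fdist_ge0 // ler_wpM2l //.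
exact: Vpi_le_opt_value.
Qed.

Lemma opt_value_ge_avg tau h : 0 <= tau -> policies_within S0 f r rho tau pi ->
  avg_reward S0 f r rho pi * (1 - g)^-1 - tau <= opt_value g h.
Proof.
by move=> tau0 pi_tau; apply: le_trans (Vpi_le_opt_value pi h); exact: Vpi_ge_avg.
Qed.
End Discount.

Lemma Qstar_discount_le g g' h a : 0 <= g' -> g' <= g -> g < 1 ->
  Qstar g h a <= Qstar g' h a + ((1 - g)^-1 - (1 - g')^-1).
Proof.
move=> g'0 g'g g1; apply: Qstar_le_bound => p.
apply: le_trans (Qpi_discount_le S0 f r01 rho p h a g'0 g'g g1) _; rewrite lerD2r.
by apply: Qpi_le_Qstar; rewrite g'0 (le_lt_trans g'g g1).
Qed.

Lemma discount_bounds (tau : R) : 1 <= tau -> 0 <= discount tau < 1.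
Proof.
move=> tau1; have tau0 : 0 < tau by exact: lt_le_trans tau1.
by rewrite /discount div1r subr_ge0 invf_le1 // tau1 gtrBl invr_gt0.
Qed.

Lemma inv_discount (tau : R) : (1 - discount tau)^-1 = tau.
Proof. by rewrite /discount opprB addrCA subrr addr0 div1r invrK. Qed.

(** All values lie between 0 and [(1 - g)^-1], so each supremum and infimum is over a bounded set
    and does bound its elements. *)
Lemma distortion_ge (tau : R) h1 h2 a : 1 <= tau -> phi h1 = phi h2 ->
  Qstar (discount tau) h1 a - Qstar (discount tau) h2 a <=
  distortion S0 f r rho tau.
Proof.
move=> /discount_bounds g01 h12; set g := discount tau in g01 *.
pose X (s : S) b := [set Qstar g h b | h in [set h | phi h = s]].
have ubX s b : has_ubound (X s b).
  by exists (1 - g)^-1 => _ [h _ <-]; exact: Qstar_le.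
have lbX s b : has_lbound (X s b).
  by exists 0 => _ [h _ <-]; exact: Qstar_ge0.
apply: (@le_trans _ _ (sup (X (phi h1) a) - inf (X (phi h1) a))).
  by apply: lerB; [apply: ub_le_sup => //; exists h1|apply: ge_inf => //; exists h2].
apply: ub_le_sup; last by exists (phi h1, a) => //=; exists h1.
exists ((1 - g)^-1 - 0) => _ [[s b] [h _ hs] <-]; apply: lerB.
  by apply: ge_sup; [exists (Qstar g h b), h|move=> _ [h' _ <-]; exact: Qstar_le].
apply: lb_le_inf; first by exists (Qstar g h b), h.
by move=> _ [h' _ <-]; exact: Qstar_ge0.
Qed.

Lemma distortion_ge0 (tau : R) : 1 <= tau -> 0 <= distortion S0 f r rho tau.
Proof.
move=> tau1; have /card_gt0P[a _] := A_gt0.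
by have := @distortion_ge tau [::] [::] a tau1 erefl; rewrite subrr.
Qed.
End OptimalValues.

(** * Phases *)

Section Phases.

Lemma ltn_change_point k : (k < change_point k)%N.
Proof. by case: k => // k; have := ltn_expl k (isT : (1 < 2)%N); rewrite /=; lia. Qed.

Lemma change_pointS k : (change_point k.+2 = 2 * change_point k.+1)%N.
Proof. by rewrite /= expnS mulnCA. Qed.

Lemma change_point_lt k : (change_point k < change_point k.+1)%N.
Proof. by case: k => // k; rewrite change_pointS; have := ltn_change_point k.+1; lia. Qed.

Lemma leq_change_point : {homo change_point : j k / (j <= k)%N}.
Proof. by apply: homo_leq leq_trans _ => // k; exact/ltnW/change_point_lt. Qed.

Lemma change_point_phase t : (0 < t)%N -> (change_point (phase t) <= t)%N.
Proof.
move=> t0; have P0 : (0 < #|[pred k : 'I_t.+1 | change_point k <= t]|)%N.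
  by apply/card_gt0P; exists ord0; rewrite inE.
have [i Pi E] := eq_bigmax_cond (fun k : 'I_t.+1 => k : nat) P0.
by rewrite /phase (_ : (\max_(k < t.+1 | _) _)%N = i) //; move: Pi; rewrite inE.
Qed.

Lemma phase_max k t : (change_point k <= t)%N -> (k <= phase t)%N.
Proof.
move=> kt; have k_lt : (k < t.+1)%N by have := ltn_change_point k; lia.
exact: (@leq_bigmax_cond _ _ (fun k : 'I_t.+1 => k : nat) (Ordinal k_lt)).
Qed.

Lemma phase_lt t : (t < change_point (phase t).+1)%N.
Proof. by rewrite ltnNge; apply/negP => /phase_max; rewrite ltnn. Qed.

Lemma phase0 : phase 0 = 0%N.
Proof.
apply/eqP; rewrite -leqn0; apply/bigmax_leqP => i.
by have := ltn_change_point i; lia.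
Qed.

Lemma leq_phase : {homo phase : s t / (s <= t)%N}.
Proof.
move=> [|s] t st; first by rewrite phase0.
exact/phase_max/(leq_trans (change_point_phase _) st).
Qed.

(** Change points are strictly increasing integers, so one time step passes at most one of them, and
    then lands on it. *)
Lemma phaseS t : phase t.+1 = phase t \/
  (phase t.+1 = (phase t).+1 /\ change_point (phase t.+1) = t.+1).
Proof.
have le1 := leq_phase (leqnSn t); have lt1 := phase_lt t.
have cp1 : (change_point (phase t.+1) <= t.+1)%N by exact: change_point_phase.
have [/eqP E|E] := boolP (phase t.+1 == phase t); first by left.
right; have {le1 E}lt2 : (phase t < phase t.+1)%N by rewrite ltn_neqAle eq_sym E.
have cp2 := leq_change_point lt2.
have E : change_point (phase t).+1 = t.+1 by lia.
suff -> : phase t.+1 = (phase t).+1 by [].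
apply/eqP; rewrite eqn_leq lt2 andbT leqNgt; apply/negP => /leq_change_point.
by have := change_point_lt (phase t).+1; lia.
Qed.

Lemma phase_start_eq s t : (phase_start s == phase_start t) = (phase s == phase t).
Proof.
have lt j k : (j < k)%N -> (change_point j < change_point k)%N.
  by move=> jk; exact: leq_trans (change_point_lt j) (leq_change_point jk).
have inj : injective change_point.
  by move=> j k E; case: (ltngtP j k) => // /lt; rewrite E ltnn.
by rewrite /phase_start (inj_eq inj).
Qed.
End Phases.

(** * Horizons and bonuses of the phases *)

Section Horizons.
Variable R : realType.

Definition phase_horizon (k : nat) : R := (change_point k)%:R `^ (1 / 5).

Lemma horizonE t : horizon R t = phase_horizon (phase t).
Proof. by []. Qed.

Lemma powR_fifth (x : R) n : 0 <= x -> x `^ (n%:R / 5) = (x `^ (1 / 5)) ^+ n.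
Proof. by move=> x0; rewrite -powR_mulrn ?powR_ge0 // -powRrM mulrC mul1r. Qed.

Lemma phase_horizon5 k : phase_horizon k ^+ 5 = (change_point k)%:R.
Proof. by rewrite -powR_fifth // divff // powRr1. Qed.

Lemma phase_horizon0 : phase_horizon 0 = 1.
Proof. by rewrite /phase_horizon powR1. Qed.

Lemma phase_horizon_le : {homo phase_horizon : j k / (j <= k)%N >-> j <= k}.
Proof.
by move=> j k jk; rewrite /phase_horizon ge0_ler_powR ?nnegrE // ler_nat leq_change_point.
Qed.

Lemma phase_horizon_ge1 k : 1 <= phase_horizon k.
Proof. by rewrite -phase_horizon0; exact: phase_horizon_le. Qed.

Lemma phase_horizonS k : phase_horizon k.+2 = (2 : R) `^ (1 / 5) * phase_horizon k.+1.
Proof. by rewrite /phase_horizon change_pointS natrM powRM. Qed.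

(** Equivalent to [(8/7)^5 <= 2 <= (7/6)^5]. The lower bound makes the horizons grow
    geometrically. *)
Lemma fifth_root2 : 8 / 7 <= (2 : R) `^ (1 / 5) <= 7 / 6.
Proof.
set w : R := 2 `^ (1 / 5).
have w0 : 0 <= w by exact: powR_ge0.
have w5 : w ^+ 5 = 2 by rewrite -powR_fifth // divff // powRr1.
have up : (8 / 7 : R) ^+ 5 <= 2.
  rewrite (_ : _ ^+ 5 = ((8 / 7) ^+ 2) ^+ 2 * (8 / 7)); last by ring.
  have le1 : (8 / 7 : R) ^+ 2 <= 21 / 16 by lra.
  have le2 : ((8 / 7 : R) ^+ 2) ^+ 2 <= 7 / 4.
    have : ((8 / 7 : R) ^+ 2) ^+ 2 <= (21 / 16) ^+ 2 by rewrite lerXn2r ?nnegrE //; lra.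
    lra.
  lra.
have down : 2 <= (7 / 6 : R) ^+ 5.
  rewrite (_ : _ ^+ 5 = ((7 / 6) ^+ 2) ^+ 2 * (7 / 6)); last by ring.
  have le2 : (4 / 3 : R) ^+ 2 <= ((7 / 6 : R) ^+ 2) ^+ 2.
    by rewrite lerXn2r ?nnegrE //; lra.
  lra.
by apply/andP; split; rewrite -(@ler_pXn2r _ 5) ?nnegrE ?w5 //; lra.
Qed.

Definition phase_log (k : nat) : R := ln (2 * (change_point k)%:R ^+ 2).

(** The power 3/10 of the change point is the power 3/2 of the horizon. *)
Definition phase_bonus (k : nat) : R :=
  4 * phase_horizon k * Num.sqrt (phase_horizon k) * Num.sqrt (phase_log k).

Lemma bonusE t : bonus R t = phase_bonus (phase t).
Proof.
rewrite /bonus /phase_bonus; congr (_ * _); rewrite -mulrA; congr (_ * _).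
set c : R := (phase_start t)%:R; have c0 : 0 <= c by [].
rewrite -/(phase_start t) /phase_horizon -/c -powR12_sqrt ?powR_ge0 // -powRrM.
rewrite -powRD; first by congr (_ `^ _); field.
by apply/implyP => _; rewrite pnatr_eq0 -lt0n (leq_ltn_trans _ (ltn_change_point _)).
Qed.

Lemma phase_log_ge1 k : (0 < k)%N -> 1 <= phase_log k.
Proof.
case: k => // k _; have c20 : 20 <= (change_point k.+1)%:R :> R.
  by rewrite ler_nat; exact: (@leq_change_point 1 k.+1).
rewrite -[1]expRK /phase_log ler_ln ?posrE ?expR_gt0 //; last first.
  by rewrite mulr_gt0 // exprn_gt0 //; lra.
apply: (@le_trans _ _ 4); last by nra.
(* This gives [expR 1 <= 4], well below [2 * 20 ^+ 2]. *)
have : expR (-1 / 2 : R) >= 1 / 2 by have := expR_ge1Dx (-1 / 2 : R); lra.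
have e0 := expR_gt0 (1 / 2 : R).
have : expR (-1 / 2 : R) * expR (1 / 2) = 1 by rewrite -expRD -expR0; congr expR; field.
have : expR (1 : R) = expR (1 / 2) * expR (1 / 2) by rewrite -expRD; congr expR; field.
nra.
Qed.

(* With [y, z] the fifth roots of [t, t - 1], the factorisation
   [y^5 - 5 y z^4 + 4 z^5 = (y - z)^2 (y^3 + 2 y^2 z + 3 y z^2 + 4 z^3)]
   bounds the increment of [t^(4/5)] from below. *)
Lemma four_fifths_increment (t : nat) (H : R) : 0 < H ->
  t.+1%:R <= 2 * H ^+ 5 ->
  H^-1 <= 3 / 2 * (t.+1%:R `^ (4 / 5) - t%:R `^ (4 / 5)).
Proof.
move=> H0 tH; rewrite !powR_fifth //.
set y : R := t.+1%:R `^ (1 / 5); set z : R := t%:R `^ (1 / 5).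
have y5 : y ^+ 5 = t.+1%:R by rewrite -powR_fifth // divff // powRr1.
have z5 : z ^+ 5 = t%:R by rewrite -powR_fifth // divff // powRr1.
have y0 : 0 < y by rewrite powR_gt0.
have z0 : 0 <= z by exact: powR_ge0.
have yz : y ^+ 5 - z ^+ 5 = 1 by rewrite y5 z5 -natr1 addrAC subrr add0r.
have inc : 4 / 5 <= y * (y ^+ 4 - z ^+ 4).
  have : 0 <= (y - z) ^+ 2 * (y ^+ 3 + 2 * y ^+ 2 * z + 3 * y * z ^+ 2 + 4 * z ^+ 3).
    by rewrite mulr_ge0 ?sqr_ge0 // !addr_ge0 ?mulr_ge0 ?exprn_ge0 // ltW.
  lra.
(* From [y ^+ 5 <= 2 * H ^+ 5]. With [inc], the increment is at least [24/35 / H], hence the factor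
   3/2. *)
have yH : y <= 7 / 6 * H.
  have /andP[_ w2] := fifth_root2; apply: le_trans (ler_wpM2r (ltW H0) w2).
  rewrite -(@ler_pXn2r _ 5) ?nnegrE ?(ltW y0) ?mulr_ge0 ?powR_ge0 ?(ltW H0) //.
  by rewrite y5 exprMn -powR_fifth // divff // powRr1.
rewrite -div1r ler_pdivrMr //; set d := y ^+ 4 - z ^+ 4 in inc *.
have d0 : 0 <= d by rewrite -(pmulr_rge0 _ y0); lra.
have := ler_wpM2r d0 yH; lra.
Qed.
End Horizons.

(** * The state of the agent *)

Section AgentState.
Variables (R : realType) (A O S : finType).
Variables (S0 : S) (f : S -> A -> O -> S) (r : S -> A -> O -> R).
Hypothesis r01 : forall s a o, 0 <= r s a o <= 1.
Local Notation phi := (phi S0 f).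
Local Notation st := (state_after S0 f r).
Local Notation prep h := (prepare (st h)).
Local Notation hor := (phase_horizon R).

Definition learning_rate (H : R) (n : nat) : R := (1 + 2 * H) / (n%:R + 2 * H).

Lemma learning_rate01 H n : 0 < H -> 0 <= learning_rate H n.+1 <= 1.
Proof.
move=> H0; have n1 : 1 <= n.+1%:R :> R by rewrite ler1n.
rewrite /learning_rate ler_pdivrMr ?mul1r; last by lra.
by rewrite divr_ge0 /=; lra.
Qed.

Lemma state_after_rcons h ao : st (rcons h ao) = learn f r (prep h) ao.1 ao.2.
Proof. by rewrite /state_after foldl_rcons. Qed.

Lemma clock_state_after h : clock (st h) = (size h).+1.
Proof.
elim/last_ind: h => [|h ao IHh] //.
by rewrite state_after_rcons size_rcons -IHh.
Qed.

Lemma cur_state_after h : cur (st h) = phi h.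
Proof.
elim/last_ind: h => [|h ao IHh] //.
by rewrite state_after_rcons phi_rcons -IHh.
Qed.

(** The tables of [st h] belong to the phase of iteration [size h]; [prepare] moves them to the
    phase of iteration [(size h).+1]. *)
Lemma Qtab_prepare h s a : Qtab (prep h) s a =
  Qtab (st h) s a + (hor (phase (size h).+1) - hor (phase (size h))).
Proof. by rewrite /= clock_state_after. Qed.

Lemma Ntab_prepare h s a : Ntab (prep h) s a =
  (Ntab (st h) s a * (phase (size h).+1 == phase (size h)))%N.
Proof. by rewrite /= clock_state_after phase_start_eq. Qed.

Lemma Ntab_rcons h ao s a : Ntab (st (rcons h ao)) s a =
  (Ntab (prep h) s a + ((s == phi h) && (a == ao.1)))%N.
Proof.
rewrite state_after_rcons [LHS]/= cur_state_after.
by case: eqP => [->|_] /=; [case: eqP => [->|_] /=|]; rewrite ?addn1 ?addn0.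
Qed.

Definition td_target h (ao : A * O) : R :=
  let k := phase (size h).+1 in
  r (phi h) ao.1 ao.2 +
  (1 - (hor k)^-1) * sup (range (Qtab (prep h) (phi (rcons h ao)))).

(** The update is put in the form of a convex combination of the old entry and the target with
    bonus, the shape that [noise_step] copies without clipping. *)
Lemma Qtab_rcons h ao s a : let k := phase (size h).+1 in
  let n := (Ntab (prep h) s a).+1 in
  Qtab (st (rcons h ao)) s a =
  if (s == phi h) && (a == ao.1) then
    Num.min ((1 - learning_rate (hor k) n) * Qtab (prep h) s a +
      learning_rate (hor k) n *
        (td_target h ao + phase_bonus R k / Num.sqrt n%:R)) (hor k)
  else Qtab (prep h) s a.
Proof.
have cx : cur (prep h) = phi h by exact: cur_state_after.
have kx : clock (prep h) = (size h).+1 by exact: clock_state_after.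
rewrite state_after_rcons /td_target; move: (prep h) cx kx => x cx kx.
set k := phase _; set n := (Ntab x s a).+1.
rewrite [LHS]/= cx; case: ifP => // /andP[/eqP sE /eqP aE].
rewrite kx horizonE bonusE -/k -sE -aE -/n phi_rcons -sE -aE.
congr Num.min; rewrite /learning_rate div1r; ring.
Qed.

Lemma Qtab_state_prepare_bounds h :
  (forall s a, 0 <= Qtab (st h) s a <= hor (phase (size h))) ->
  forall s a, 0 <= Qtab (prep h) s a <= hor (phase (size h).+1).
Proof.
move=> Qh s a; rewrite Qtab_prepare; case/andP: (Qh s a) => Q0 QH.
have : hor (phase (size h)) <= hor (phase (size h).+1).
  exact/phase_horizon_le/leq_phase.
by move=> Hle; apply/andP; split; lra.
Qed.

Lemma phase_bonus_ge0 k : 0 <= phase_bonus R k.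
Proof.
by rewrite /phase_bonus !mulr_ge0 ?sqrtr_ge0 // (le_trans ler01) ?phase_horizon_ge1.
Qed.

Lemma td_target_ge0 h ao : (forall s a, 0 <= Qtab (prep h) s a) -> 0 <= td_target h ao.
Proof.
move=> Q0; have H1 := phase_horizon_ge1 R (phase (size h).+1).
rewrite addr_ge0 //; first by case/andP: (r01 (phi h) ao.1 ao.2).
rewrite mulr_ge0 // ?subr_ge0 ?invf_le1 ?(lt_le_trans ltr01) //.
by apply: le_trans (le_sup_range _ ao.1).
Qed.

Lemma Qtab_state_bounds h s a : 0 <= Qtab (st h) s a <= hor (phase (size h)).
Proof.
elim/last_ind: h s a => [|h ao IHh] s a.
  by rewrite /= phase0 phase_horizon0 ler01 lexx.
have Qp := Qtab_state_prepare_bounds IHh.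
rewrite Qtab_rcons size_rcons; case: ifP => // _.
set n := Ntab _ _ _; set k := phase _ in Qp *.
have H1 := phase_horizon_ge1 R k; have H0 : 0 < hor k by lra.
have /andP[al0 al1] := learning_rate01 n H0.
rewrite ge_min lexx orbT andbT le_min (ltW H0) andbT.
have Q0 s' a' : 0 <= Qtab (prep h) s' a' by case/andP: (Qp s' a').
apply: addr_ge0; apply: mulr_ge0 => //; first by rewrite subr_ge0.
apply: addr_ge0; first exact: td_target_ge0.
by apply: divr_ge0; [exact: phase_bonus_ge0|exact: sqrtr_ge0].
Qed.

Lemma Qtab_prepare_bounds h s a : 0 <= Qtab (prep h) s a <= hor (phase (size h).+1).
Proof. by apply: Qtab_state_prepare_bounds => s' a'; exact: Qtab_state_bounds. Qed.

(** Each iteration adds one count, and at a new phase the counts restart from 0 just when the clock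
    equals its change point. From phase 1 on, change points double, whence [sum_Ntab_le]. *)
Lemma sum_Ntab h :
  (\sum_s \sum_a Ntab (st h) s a + change_point (phase (size h)) <= (size h).+1)%N.
Proof.
elim/last_ind: h => [|h ao IHh].
  by rewrite phase0 big1 // => s _; rewrite big1.
have -> : (\sum_s \sum_a Ntab (st (rcons h ao)) s a =
    (\sum_s \sum_a Ntab (st h) s a) * (phase (size h).+1 == phase (size h)) + 1)%N.
  rewrite big_distrl -[1%N]/(true : nat).
  transitivity (\sum_s (\sum_a Ntab (prep h) s a + (s == phi h)))%N; last first.
    rewrite big_split; congr (_ + _)%N.
      apply: eq_bigr => s _; rewrite big_distrl.
      by apply: eq_bigr => a _; rewrite Ntab_prepare.
    rewrite (bigD1 (phi h)) //= eqxx big1 ?addn0 // => s /negbTE ->.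
    by [].
  apply: eq_bigr => s _; under eq_bigr do rewrite Ntab_rcons.
  rewrite big_split; congr (_ + _)%N; case: (s == phi h); last by rewrite big1.
  by rewrite (bigD1 ao.1) //= eqxx big1 ?addn0 // => a /negbTE ->.
rewrite size_rcons; case: (phaseS (size h)) => [->|[E1 E2]].
  by rewrite eqxx muln1 addn1 addSn ltnS.
by rewrite E2 E1 gtn_eqF ?ltnS // muln0.
Qed.

Lemma sum_Ntab_le h : (0 < phase (size h))%N ->
  (\sum_s \sum_a Ntab (st h) s a <= change_point (phase (size h)))%N.
Proof.
move=> k0; have := sum_Ntab h; have := phase_lt (size h).
case: (phase (size h)) k0 => // k _; rewrite change_pointS; lia.
Qed.

Lemma Ntab_le h s a : (0 < phase (size h))%N ->
  (Ntab (st h) s a <= change_point (phase (size h)))%N.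
Proof.
move=> /sum_Ntab_le; apply: leq_trans; rewrite (bigD1 s) //= (bigD1 a) //=.
by rewrite -addnA leq_addr.
Qed.
End AgentState.

(** * Recursion on the last step of a history *)

Section HistoryRecursion.
Variables (A O : finType) (X : Type).
Variables (step : history A O -> X -> A * O -> X) (x0 : X).

(** The fold carries the prefix read so far, so that a step may depend on the whole past. *)
Definition hist_rec (h : history A O) : X :=
  (foldl (fun p ao => (rcons p.1 ao, step p.1 p.2 ao)) ([::], x0) h).2.

Lemma hist_rec_rcons h ao : hist_rec (rcons h ao) = step h (hist_rec h) ao.
Proof.
rewrite /hist_rec foldl_rcons; congr step.
elim/last_ind: h => [|h b IHh] //.
by rewrite foldl_rcons /= IHh.
Qed.
End HistoryRecursion.

(** * Weights of the samples of a cell *)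

Section Weights.
Variables (R : realType) (H : R).
Hypothesis H0 : 0 < H.
Local Notation alpha := (learning_rate H).

(* [noise_weight n * alpha_n^i] does not depend on [n], where [alpha_n^i] is
   the weight that the [n]-th iterate gives to the [i]-th sample. *)
Fixpoint noise_weight (n : nat) : R :=
  if n is m.+1 then
    if m is 0%N then 1 else noise_weight m * ((n%:R + 2 * H) / m%:R)
  else 0.

(** The sum over [i <= n] of the squared weights that the [n]-th iterate gives to the [i]-th
    sample. *)
Fixpoint noise_var (n : nat) : R :=
  if n is m.+1 then (1 - alpha n) ^+ 2 * noise_var m + alpha n ^+ 2 else 0.

(** Multiplied by [noise_weight], the averaged noise becomes a plain sum of samples with fixed
    coefficients. At [n = 0] both sides vanish, as the first rate is 1. *)
Lemma noise_weightS n : noise_weight n.+1 * (1 - alpha n.+1) = noise_weight n.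
Proof.
have nH (m : nat) : m.+1%:R + 2 * H != 0.
  by rewrite gt_eqF // ltr_wpDl // mulr_gt0.
case: n => [|n]; rewrite /learning_rate.
  by rewrite /= divff ?subrr ?mulr0 // (nH 0%N).
have -> : noise_weight n.+2 = noise_weight n.+1 * ((n.+2%:R + 2 * H) / n.+1%:R) by [].
have n1 : n.+1%:R != 0 :> R by rewrite pnatr_eq0.
have := nH n.+1; rewrite -(natr1 n.+1); move: (n.+1%:R : R) n1 => x x0 x1.
by field; rewrite x0 x1.
Qed.

Lemma noise_weight_gt0 n : 0 < noise_weight n.+1.
Proof.
elim: n => [|n IHn] //=; rewrite mulr_gt0 // divr_gt0 //.
by rewrite ltr_wpDl // mulr_gt0.
Qed.

(** With [v (4H + 1) = (1 + 2H)^2], the induction step compares [(x + 1)(x + 1 + 4H)] with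
    [(x + 1 + 2H)^2], which exceeds it by [4H^2]. *)
Lemma noise_var_le n :
  noise_var n.+1 <= (1 + 2 * H) ^+ 2 / (4 * H + 1) / n.+1%:R.
Proof.
have Hp := H0; set v := _ / (4 * H + 1).
have vE : v * (4 * H + 1) = (1 + 2 * H) ^+ 2.
  by rewrite /v divfK // gt_eqF // addr_gt0 // mulr_gt0.
have v0 : 0 <= v by apply: divr_ge0; [exact: sqr_ge0|lra].
elim: n => [|n IHn].
  rewrite /= /learning_rate divff ?subrr; last by rewrite gt_eqF // addr_gt0 // mulr_gt0.
  rewrite mulr0 add0r expr1n divr1 /v ler_pdivlMr; last by lra.
  by have := sqr_ge0 H; lra.
rewrite [noise_var _]/= -/(noise_var n.+1).
have n0 : 0 < n.+1%:R :> R by rewrite ltr0n.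
rewrite /learning_rate -(natr1 n.+1); set x : R := n.+1%:R in n0 IHn *.
clearbody x; have x1 : 0 < x + 1 + 2 * H by lra.
have xn : x != 0 by rewrite gt_eqF.
have x1n : x + 1 + 2 * H != 0 by rewrite gt_eqF.
have -> : 1 - (1 + 2 * H) / (x + 1 + 2 * H) = x / (x + 1 + 2 * H).
  by field.
apply: (@le_trans _ _ ((x / (x + 1 + 2 * H)) ^+ 2 * (v / x) +
    ((1 + 2 * H) / (x + 1 + 2 * H)) ^+ 2)).
  by rewrite lerD2r ler_wpM2l ?sqr_ge0.
rewrite [X in X + _](_ : _ = x * v / (x + 1 + 2 * H) ^+ 2); last first.
  by field; rewrite x1n xn.
rewrite expr_div_n -mulrDl ler_pdivrMr ?exprn_gt0 // mulrAC ler_pdivlMr; last by lra.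
rewrite -vE -subr_ge0 (_ : _ - _ = v * (4 * H ^+ 2)); last by ring.
by rewrite mulr_ge0 // mulr_ge0 ?sqr_ge0.
Qed.
End Weights.

(** * Concentration of the noise *)

Section Concentration.
Variables (R : realType) (A O S : finType).
Variables (S0 : S) (f : S -> A -> O -> S) (r : S -> A -> O -> R).
Hypothesis r01 : forall s a o, 0 <= r s a o <= 1.
Variables (rho : environment R A O) (pi : policy R A O).
Local Notation phi := (phi S0 f).
Local Notation st := (state_after S0 f r).
Local Notation prep h := (prepare (st h)).

Lemma normr1_cases (t : R) : `|t| = 1 -> t = 1 \/ t = -1.
Proof. by case: (ger0P t) => _ <-; [left|right; rewrite opprK]. Qed.

Section Noise.
Variables (k : nat) (U : history A O -> R) (c J : R).
Hypothesis U_bounds : forall h, c <= U h <= c + J.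
Local Notation H := (phase_horizon R k).
Local Notation L := (phase_log R k).
Local Notation width := (1 + J).

Definition backup h (ao : A * O) : R :=
  r (phi h) ao.1 ao.2 + (1 - H^-1) * U (rcons h ao).

Definition noise h (ao : A * O) : R :=
  backup h ao - \sum_o rho h ao.1 o * backup h (ao.1, o).

Definition noise_step h (e : S -> A -> R) (ao : A * O) (s : S) (a : A) : R :=
  if (s == phi h) && (a == ao.1) then
    let n := (Ntab (prep h) s a).+1 in
    (1 - learning_rate H n) * e s a + learning_rate H n * noise h ao
  else e s a.

(** Defined along the whole history. In phase [k] the counts restart, and the first rate 1 erases
    what a cell had accumulated before. *)
Definition noise_table := hist_rec noise_step (fun _ _ => 0).

Let H1 : 1 <= H. Proof. exact: phase_horizon_ge1. Qed.
Let H0 : 0 < H. Proof. exact: lt_le_trans H1. Qed.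
Let J0 : 0 <= J.
Proof. by case/andP: (U_bounds [::]) => cU Uc; rewrite -(lerD2l c) addr0 (le_trans cU). Qed.

Lemma backup_bounds h ao :
  (1 - H^-1) * c <= backup h ao <= (1 - H^-1) * c + width.
Proof.
have H1' := H1; have H0' := H0; have J0' := J0; rewrite /backup.
case/andP: (r01 (phi h) ao.1 ao.2) => r0 r1.
case/andP: (U_bounds (rcons h ao)) => cU Uc.
have g0 : 0 <= 1 - H^-1 by rewrite subr_ge0 invf_le1.
have g1 : 1 - H^-1 <= 1 by rewrite gerBl invr_ge0 ltW.
have := ler_wpM2l g0 cU; have := ler_wpM2l g0 Uc; have := ler_wpM2r J0' g1.
move=> *; apply/andP; split; lra.
Qed.

Lemma noise_le h ao : `|noise h ao| <= width.
Proof.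
have cst (x : R) : x = \sum_o rho h ao.1 o * x by rewrite -mulr_suml fdist_sum1 mul1r.
have /andP[b1 b2] := backup_bounds h ao.
set lo := (1 - H^-1) * c in b1 b2.
have m1 : lo <= \sum_o rho h ao.1 o * backup h (ao.1, o).
  rewrite [leLHS]cst; apply: ler_sum => o _; rewrite ler_wpM2l ?fdist_ge0 //.
  by case/andP: (backup_bounds h (ao.1, o)).
have m2 : \sum_o rho h ao.1 o * backup h (ao.1, o) <= lo + width.
  rewrite [leRHS]cst; apply: ler_sum => o _; rewrite ler_wpM2l ?fdist_ge0 //.
  by case/andP: (backup_bounds h (ao.1, o)).
rewrite ler_norml /noise; apply/andP; split; lra.
Qed.

(** The exponent of the Hoeffding supermartingale with parameter [y]:
    [noise_weight ^+ 2 * noise_var] is the sum of the squared coefficients. *)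
Definition mart_exponent (y : R) (N : nat) (e : R) : R :=
  y * (noise_weight H N * e) -
  y ^+ 2 * width ^+ 2 / 8 * (noise_weight H N ^+ 2 * noise_var H N).

Lemma mart_exponentS y N e x :
  let al := learning_rate H N.+1 in
  let z := y * noise_weight H N.+1 * al in
  mart_exponent y N.+1 ((1 - al) * e + al * x) =
  mart_exponent y N e + (z * x - z ^+ 2 * width ^+ 2 / 8).
Proof.
move=> al z; rewrite /mart_exponent -(noise_weightS H0 N) -/al.
have -> : noise_var H N.+1 = (1 - al) ^+ 2 * noise_var H N + al ^+ 2 by [].
by rewrite /z; field.
Qed.

(* Killing the process when the phase is over keeps it a supermartingale, since
   it is nonnegative. *)
Definition noise_mart (y : R) (s : S) (a : A) (h : history A O) : R :=
  if (phase (size h) < k)%N then 1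
  else if phase (size h) == k then
    expR (mart_exponent y (Ntab (st h) s a) (noise_table h s a))
  else 0.

Lemma noise_mart_ge0 y s a h : 0 <= noise_mart y s a h.
Proof. by rewrite /noise_mart; case: ifP => // _; case: ifP => // _; exact: expR_ge0. Qed.

(** When phase [k] starts, the reset counts make the exponent 0, in agreement with the value 1 given
    to earlier phases. *)
Lemma noise_mart_prepare y s a h : phase (size h).+1 = k ->
  noise_mart y s a h =
  expR (mart_exponent y (Ntab (prep h) s a) (noise_table h s a)).
Proof.
move=> kE; rewrite /noise_mart Ntab_prepare kE.
case: (phaseS (size h)) => [E|[E _]]; rewrite -kE E.
  by rewrite ltnn eqxx muln1.
by rewrite ltnSn gtn_eqF // muln0 /mart_exponent /= !(mul0r, mulr0, expr0n) subrr expR0.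
Qed.

(** A step changes the exponent only at the visited cell, where the noise is centred with range
    [width] and Hoeffding's lemma applies for each fixed action. *)
Lemma noise_mart_super y s a h :
  step_mean rho pi h (fun ao => noise_mart y s a (rcons h ao)) <= noise_mart y s a h.
Proof.
have [kE|kE] := eqVneq (phase (size h).+1) k; last first.
  rewrite -[leRHS](step_mean_cst rho pi h); apply: step_mean_le => ao.
  rewrite {1}/noise_mart size_rcons (negbTE kE); case: ltnP => [lt|_].
    rewrite /noise_mart ifT //; apply: leq_ltn_trans lt; exact/leq_phase.
  exact: noise_mart_ge0.
rewrite noise_mart_prepare //; set M := expR _.
pose z := y * noise_weight H (Ntab (prep h) s a).+1 *
  learning_rate H (Ntab (prep h) s a).+1.
have E a' o : noise_mart y s a (rcons h (a', o)) =
    if (s == phi h) && (a == a') then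
      M * expR (- (z ^+ 2 * width ^+ 2 / 8)) * expR (z * noise h (a', o))
    else M.
  rewrite /noise_mart size_rcons kE ltnn eqxx Ntab_rcons /noise_table hist_rec_rcons.
  rewrite -/noise_table /noise_step /=; case: ifP => [_|_]; last by rewrite addn0.
  by rewrite addn1 mart_exponentS /M -!expRD; congr expR; rewrite [RHS]addrAC addrA.
apply: (@le_trans _ _ (\sum_a' pi h a' * \sum_o rho h a' o *
    noise_mart y s a (rcons h (a', o)))).
  rewrite -(step_meanE rho pi h (fun a' o => noise_mart y s a (rcons h (a', o)))).
  by rewrite le_eqVlt; apply/orP; left; apply/eqP; apply: eq_bigr => -[].
rewrite -[leRHS]mul1r -(fdist_sum1 (pi h)) mulr_suml; apply: ler_sum => a' _.
rewrite ler_wpM2l ?fdist_ge0 //; under eq_bigr do rewrite E.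
case: (_ && _); last by rewrite -mulr_suml fdist_sum1 mul1r.
under eq_bigr do rewrite mulrCA.
rewrite -mulr_sumr -mulrA ler_piMr ?expR_ge0 // expRN mulrC ler_pdivrMr ?expR_gt0 // mul1r.
apply: (@hoeffding_lemma _ _ (rho h a') (fun o => backup h (a', o)) ((1 - H^-1) * c)).
  by have J0' := J0; lra.
by move=> o; exact: backup_bounds.
Qed.

Definition noise_bound : R := 3 / 20 * phase_bonus R k.

(** Chosen so that the linear part of the exponent is [2 * L] when the averaged noise equals
    [noise_bound / Num.sqrt n]. *)
Definition mart_scale (n : nat) : R :=
  2 * L * Num.sqrt n%:R / (noise_bound * noise_weight H n).

(** A union bound over cells, counts and signs, done inside one supermartingale. As [expR (- L)] is
    [1 / (2 T_k^2)], each cell contributes [1 / T_k] at the start. *)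
Definition failure_mart (h : history A O) : R :=
  \sum_s \sum_a \sum_(n < change_point k)
    (noise_mart (mart_scale n.+1) s a h + noise_mart (- mart_scale n.+1) s a h) *
    expR (- L).

Lemma failure_mart_ge0 h : 0 <= failure_mart h.
Proof.
do 3![apply: sumr_ge0 => ? _]; rewrite mulr_ge0 ?expR_ge0 // addr_ge0 //;
  exact: noise_mart_ge0.
Qed.

Lemma failure_mart_super h :
  step_mean rho pi h (fun ao => failure_mart (rcons h ao)) <= failure_mart h.
Proof.
rewrite step_mean_sum; apply: ler_sum => s _.
rewrite step_mean_sum; apply: ler_sum => a _.
rewrite step_mean_sum; apply: ler_sum => n _.
under [X in step_mean _ _ _ X]funext do rewrite mulrC.
rewrite step_meanZ mulrC ler_wpM2r ?expR_ge0 // step_meanD.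
by apply: lerD; exact: noise_mart_super.
Qed.

Lemma failure_mart_nil : (0 < k)%N ->
  failure_mart [::] = #|S|%:R * #|A|%:R / (change_point k)%:R.
Proof.
move=> k0; rewrite /failure_mart.
have M1 y s a : noise_mart y s a [::] = 1 by rewrite /noise_mart phase0 k0.
under eq_bigr do under eq_bigr do under eq_bigr do rewrite !M1.
have cp0 : (0 < change_point k)%N by exact: leq_ltn_trans (ltn_change_point k).
have cpR : (change_point k)%:R != 0 :> R by rewrite pnatr_eq0 -lt0n.
have sum_cst (I : finType) (x : R) : \sum_(i : I) x = #|I|%:R * x.
  by rewrite sumr_const mulr_natl.
rewrite !sum_cst card_ord.
rewrite expRN lnK; last by rewrite posrE mulr_gt0 // exprn_gt0 // ltr0n.
by field; exact: cpR.
Qed.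

(** If the sum is below 1, each exponent is below [L]. The variance part is at most [L] by the
    hypothesis on [noise_bound], so the linear part is below [2 * L] for both signs. *)
Lemma failure_mart_small h s a : (0 < k)%N ->
  L * width ^+ 2 * ((1 + 2 * H) ^+ 2 / (4 * H + 1)) <= 2 * noise_bound ^+ 2 ->
  failure_mart h < 1 -> phase (size h) = k -> (0 < Ntab (st h) s a)%N ->
  `|noise_table h s a| <= noise_bound / Num.sqrt (Ntab (st h) s a)%:R.
Proof.
move=> k0 conc small kE N0; set n := Ntab _ _ _ in N0 *; set e := noise_table h s a.
have L1 : 1 <= L by exact: phase_log_ge1.
have H0' := H0; have H1' := H1; have J0' := J0.
have n_le : (n <= change_point k)%N by rewrite -kE Ntab_le // kE.
have nE : n = n.-1.+1 by rewrite prednK.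
have lt_n : (n.-1 < change_point k)%N by rewrite -nE.
have nR : 0 < n%:R :> R by rewrite ltr0n.
have sn0 : 0 < Num.sqrt n%:R :> R by rewrite sqrtr_gt0.
have K0 : 0 < noise_bound.
  by rewrite /noise_bound /phase_bonus !mulr_gt0 // ?sqrtr_gt0; lra.
have w0 : 0 < noise_weight H n by rewrite nE noise_weight_gt0.
set y := mart_scale n.
have exponent_lt (t : R) : `|t| = 1 -> mart_exponent (t * y) n e < L.
  move=> t1; rewrite -subr_lt0 -expR_lt1 expRD.
  apply: le_lt_trans small; rewrite /failure_mart.
  rewrite (bigD1 s) //= (bigD1 a) //= (bigD1 (Ordinal lt_n)) //= -nE -/y.
  have M0 := noise_mart_ge0.
  have M_t : noise_mart (t * y) s a h <=
      noise_mart y s a h + noise_mart (- y) s a h.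
    have [->|->] := normr1_cases t1; rewrite ?mul1r ?mulN1r ?lerDl ?lerDr //.
  rewrite -[leLHS]addr0 lerD //.
    rewrite -[leLHS]addr0 lerD //.
      rewrite -[leLHS]addr0 lerD //.
        rewrite ler_wpM2r ?expR_ge0 //.
        by move: M_t; rewrite {1}/noise_mart kE ltnn eqxx.
      by apply: sumr_ge0 => i _; rewrite mulr_ge0 ?expR_ge0 // addr_ge0.
    by do 2![apply: sumr_ge0 => ? _]; rewrite mulr_ge0 ?expR_ge0 // addr_ge0.
  by do 3![apply: sumr_ge0 => ? _]; rewrite mulr_ge0 ?expR_ge0 // addr_ge0.
have var_small : y ^+ 2 * width ^+ 2 / 8 * (noise_weight H n ^+ 2 * noise_var H n) <= L.
  have := noise_var_le H0 n.-1; rewrite -nE.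
  set v := _ / _ / _ => var_le.
  apply: (@le_trans _ _ ((2 * L * Num.sqrt n%:R / noise_bound) ^+ 2 * width ^+ 2 / 8 * v)).
    have -> : y ^+ 2 * width ^+ 2 / 8 * (noise_weight H n ^+ 2 * noise_var H n) =
        (2 * L * Num.sqrt n%:R / noise_bound) ^+ 2 * width ^+ 2 / 8 * noise_var H n.
      by rewrite /y /mart_scale; field; rewrite !gt_eqF.
    by rewrite ler_wpM2l // divr_ge0 // mulr_ge0 ?sqr_ge0.
  rewrite /v expr_div_n exprMn sqr_sqrtr ?ler0n // exprMn.
  move: conc; set v' := _ / (4 * H + 1) => conc.
  have -> : 2 ^+ 2 * L ^+ 2 * n%:R / noise_bound ^+ 2 * width ^+ 2 / 8 * (v' / n%:R) =
      L * (L * width ^+ 2 * v') / (2 * noise_bound ^+ 2).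
    by field; rewrite !gt_eqF.
  have K2 : 0 < 2 * noise_bound ^+ 2 by rewrite mulr_gt0 // exprn_gt0.
  rewrite ler_pdivrMr //; apply: ler_wpM2l conc; lra.
have yw : y * noise_weight H n = 2 * L / (noise_bound / Num.sqrt n%:R).
  by rewrite /y /mart_scale; field; rewrite !gt_eqF.
have bound (t : R) : `|t| = 1 -> t * e <= noise_bound / Num.sqrt n%:R.
  move=> t1; have := exponent_lt t t1; rewrite /mart_exponent.
  have -> : (t * y) ^+ 2 = y ^+ 2.
    by rewrite exprMn -[t ^+ 2]ger0_norm ?sqr_ge0 // normrX t1 expr1n mul1r.
  have -> : t * y * (noise_weight H n * e) = y * noise_weight H n * (t * e) by ring.
  rewrite yw; set b := noise_bound / _; have b0 : 0 < b by rewrite divr_gt0.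
  move=> lt; have : 2 * L / b * (t * e) <= 2 * L by lra.
  by rewrite mulrAC ler_pdivrMr // ler_pM2l ?mulr_gt0 //; lra.
rewrite ler_norml lerNl -mulN1r bound ?normrN1 //=.
by rewrite -[leLHS]mul1r bound ?normr1.
Qed.
End Noise.
End Concentration.

(** * Optimism *)

Section OptimismCell.
Variable R : realType.

(* [D] is the excess of a table entry over its comparator and [E] the averaged
   noise of that entry.  Clipping the entry at the horizon restarts the excess
   at [C] but not the noise, so that [D] can be compared with [E] only once the
   bonus has fallen below the margin [C]. *)
Definition cell_invariant (w be : R) (n : nat) (D E : R) : Prop :=
  (5 / 3 * w <= be / Num.sqrt n%:R -> 2 / 3 * w <= D) /\
  (be / Num.sqrt n%:R < 5 / 3 * w -> 3 / 20 * be / Num.sqrt n%:R <= D - E).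

(** While the bonus is at least [5/3 w], it exceeds any noise by [2/3 w], which keeps [D] at that
    level. Later, without clipping, [D - E] follows the averaged bonuses, and clipping leaves [D']
    at least [2/3 w]; then [D' >= 0] because the averaged noise is at most [3/20] of the bonus. *)
Lemma cell_invariantS (H w be C D D' E x : R) (n : nat) :
  let al := learning_rate H n.+1 in
  let E' := (1 - al) * E + al * x in
  0 < H -> 0 < w -> 5 / 3 * w <= be -> 2 / 3 * w <= C -> `|x| <= w -> 0 <= D ->
  ((0 < n)%N -> cell_invariant w be n D E) ->
  ((0 < n)%N -> `|E| <= 3 / 20 * be / Num.sqrt n%:R) ->
  `|E'| <= 3 / 20 * be / Num.sqrt n.+1%:R ->
  Num.min ((1 - al) * D + al * (x + be / Num.sqrt n.+1%:R)) C <= D' ->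
  0 <= D' /\ cell_invariant w be n.+1 D' E'.
Proof.
move=> al E' H0 w0 w_be wC xw D0 inv Eb E'b D'ge.
have /andP[al0 al1] : 0 <= al <= 1 by exact: learning_rate01.
have al_first : n = 0%N -> al = 1.
  by move=> n0; rewrite /al n0 /learning_rate divff // gt_eqF // addr_gt0 // mulr_gt0.
clearbody al.
set q := Num.sqrt n.+1%:R in E'b D'ge *.
have q0 : 0 < q by rewrite sqrtr_gt0 ltr0n.
set b' := be / q in D'ge *.
have KE (p : R) : 3 / 20 * be / p = 3 / 20 * (be / p) by rewrite mulrA.
move: xw E'b; rewrite KE -/b' !ler_norml => /andP[x1 x2] /andP[E'1 E'2].
have ca : 0 <= 1 - al by lra.
have [big|small] := leP (5 / 3 * w) b'.
  have D'w : 2 / 3 * w <= D'.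
    apply: le_trans D'ge; rewrite le_min wC andbT.
    have [n0|n0] := posnP n; first by rewrite (al_first n0); lra.
    have [big_n _] := inv n0.
    have Dw : 2 / 3 * w <= D.
      apply: big_n; apply: le_trans big _.
      apply: ler_wpM2l; first by lra.
      by rewrite lef_pV2 ?posrE ?sqrtr_gt0 ?ltr0n // ler_wsqrtr // ler_nat.
    have := ler_wpM2l ca Dw; have : al * (2 / 3 * w) <= al * (x + b').
      by apply: ler_wpM2l => //; lra.
    lra.
  split; first lra.
  by split => // small; move: big; rewrite leNgt small.
have n0 : (0 < n)%N.
  rewrite lt0n; apply/eqP => nE; move: small.
  by rewrite /b' /q nE sqrtr1 divr1 ltNge w_be.
have [inv1 inv2] := inv n0; have := Eb n0; rewrite KE ler_norml => /andP[E1 E2].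
set p := Num.sqrt n%:R in inv1 inv2 E1 E2.
have p0 : 0 < p by rewrite sqrtr_gt0 ltr0n.
have be0 : 0 < be by lra.
have qp : q <= 3 / 2 * p.
  rewrite -(@ler_pXn2r _ 2) ?nnegrE ?(ltW q0) //; last by rewrite mulr_ge0 // ltW.
  rewrite exprMn !sqr_sqrtr ?ler0n // -natr1.
  have : 1 <= n%:R :> R by rewrite ler1n.
  lra.
have pq : p <= q by rewrite ler_wsqrtr // ler_nat.
set b := be / p in inv1 inv2 E1 E2.
have b'b : b' <= b by rewrite ler_pM2l // lef_pV2.
have bb' : b <= 3 / 2 * b'.
  have ip : p^-1 <= 3 / 2 * q^-1.
    by rewrite -div1r ler_pdivrMr // mulrAC ler_pdivlMr // mul1r.
  by have := ler_wpM2l (ltW be0) ip; rewrite mulrCA.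
(* If the bonus has just crossed the threshold, [E <= 3/20 b <= 9/40 b' <= 3/8 w] and
   [3/20 b' <= 1/4 w], together below [2/3 w]. *)
have DE : 3 / 20 * b' <= D - E.
  have [large|small_n] := leP (5 / 3 * w) b; last first.
    by have := inv2 small_n; rewrite KE -/b; clearbody b b'; lra.
  by have := inv1 large; clearbody b b'; lra.
have D'E' : 3 / 20 * b' <= D' - E'.
  move: D'ge; rewrite ge_min => /orP[D'ge|D'ge].
    rewrite lerBrDr; apply: le_trans D'ge; rewrite /E'.
    have b'0 : 0 <= b' by rewrite divr_ge0 // ltW.
    have := ler_wpM2l ca DE; have := mulr_ge0 al0 b'0; lra.
  lra.
by split; [lra|split=> [large|_]; [move: small; rewrite ltNge large|rewrite KE]].
Qed.
End OptimismCell.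

Section Optimism.
Variables (R : realType) (A O S : finType) (A_gt0 : (0 < #|A|)%N).
Variables (S0 : S) (f : S -> A -> O -> S) (r : S -> A -> O -> R).
Hypothesis r01 : forall s a o, 0 <= r s a o <= 1.
Variables (rho : environment R A O) (pi : policy R A O) (tau Dl : R).
Hypothesis tau1 : 1 <= tau.
Hypothesis pi_tau : policies_within S0 f r rho tau pi.
Hypothesis distortion_le :
  forall tau' : R, tau <= tau' -> distortion S0 f r rho tau' <= Dl.
Local Notation phi := (phi S0 f).
Local Notation st := (state_after S0 f r).
Local Notation prep h := (prepare (st h)).
Local Notation hor := (phase_horizon R).
Local Notation lam := (avg_reward S0 f r rho pi).

(* In a phase of horizon [H] the table is compared with the optimal values for
   the shorter horizon [3/5 H], shifted upwards.  Compared with the values for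
   the horizon [H] itself, this leaves a margin below the clipping level [H]
   that is proportional to the range of the values. *)
Definition short_horizon (k : nat) : R := 3 / 5 * hor k.
(** This places the short horizon above [tau], where the distortion is controlled, and since
    [tau >= 1] it gives [H >= 17/3] for the numerical estimates. *)
Definition good_phase (k : nat) : bool := 5 / 3 * tau + 4 < hor k.
Definition value_floor (k : nat) : R := Num.max 0 (lam * short_horizon k - tau).
Definition value_range (k : nat) : R := short_horizon k - value_floor k.
Definition comparator (k : nat) (h : history A O) (a : A) : R :=
  Qstar S0 f r rho (discount (short_horizon k)) h a + 2 / 3 * value_floor k.
Definition short_value (k : nat) : history A O -> R :=
  opt_value S0 f r rho (discount (short_horizon k)).

Let lam01 : 0 <= lam <= 1. Proof. exact: avg_reward_01 pi_tau. Qed.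
Let tau0 : 0 <= tau. Proof. exact: le_trans tau1. Qed.

Lemma good_phase_gt0 k : good_phase k -> (0 < k)%N.
Proof.
rewrite /good_phase; case: k => // ; rewrite phase_horizon0.
by have t1 := tau1; lra.
Qed.

Lemma value_floor_ge0 k : 0 <= value_floor k.
Proof. by rewrite le_max lexx. Qed.

Lemma value_floor_ge k : lam * short_horizon k - tau <= value_floor k.
Proof. by rewrite le_max lexx orbT. Qed.

Lemma short_horizon_ge0 k : 0 <= short_horizon k.
Proof. by rewrite mulr_ge0 // (le_trans ler01) ?phase_horizon_ge1. Qed.

Lemma value_floor_le k : value_floor k <= short_horizon k.
Proof.
rewrite ge_max short_horizon_ge0 /=; case/andP: lam01 => l0 l1.
have := ler_wpM2r (short_horizon_ge0 k) l1; have := tau0; lra.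
Qed.

Section GoodPhase.
Variable k : nat.
Hypothesis good : good_phase k.
Local Notation H := (hor k).

Let good' : 5 / 3 * tau + 4 < H. Proof. exact: good. Qed.

Lemma short_horizon_ge : tau <= short_horizon k.
Proof. by have g := good'; rewrite /short_horizon; lra. Qed.

Let short1 : 1 <= short_horizon k. Proof. exact: le_trans tau1 short_horizon_ge. Qed.

Lemma short_value_bounds h :
  value_floor k <= short_value k h <= value_floor k + value_range k.
Proof.
have g01 := discount_bounds short1.
have := opt_value_le A_gt0 S0 f r01 rho pi g01 h; rewrite inv_discount => le_short.
rewrite /value_range addrCA subrr addr0 le_short andbT ge_max.
rewrite (opt_value_ge0 S0 f r01 rho pi g01) /=.
have := opt_value_ge_avg r01 g01 h tau0 pi_tau.
by rewrite inv_discount.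
Qed.

(** The short optimal value is at most [3/5 H], and [2/3] of the short horizon is the remaining
    [2/5 H]. *)
Lemma comparator_le_horizon h a : comparator k h a <= H - 2 / 3 * value_range k.
Proof.
have := Qstar_le S0 f r01 rho pi (discount_bounds short1) h a.
by rewrite inv_discount /comparator /value_range /short_horizon; lra.
Qed.

(** The short discount is [1 - 1/H - 2/(3H)]. The extra loss [2/3 u / H] on a value
    [u >= value_floor k] pays for discounting the shift [2/3 value_floor k] at rate [1/H]. *)
Lemma comparator_backup h a :
  comparator k h a <= \sum_o rho h a o * backup S0 f r k (short_value k) h (a, o) +
    (1 - H^-1) * (2 / 3 * value_floor k).
Proof.
have Hp : 0 < H by exact: lt_le_trans (phase_horizon_ge1 R k).
have Hn : H != 0 by rewrite gt_eqF.
apply: (@le_trans _ _ (\sum_o rho h a o *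
    (backup S0 f r k (short_value k) h (a, o) - 2 / 3 * value_floor k / H) +
    2 / 3 * value_floor k)).
  rewrite /comparator lerD2r.
  have bell := Qstar_bellman_le S0 f r01 rho pi (discount_bounds short1) h a.
  apply: le_trans bell _.
  apply: ler_sum => o _; rewrite ler_wpM2l ?fdist_ge0 // /backup /= -addrA lerD2l.
  rewrite -/(short_value k (rcons h (a, o))); set u := short_value _ _.
  have /andP[u_ge _] : value_floor k <= u <= value_floor k + value_range k.
    exact: short_value_bounds.
  have -> : discount (short_horizon k) = 1 - H^-1 - 2 / 3 / H.
    by rewrite /discount /short_horizon; field.
  have : 2 / 3 * value_floor k / H <= 2 / 3 * u / H.
    by rewrite ler_wpM2r ?invr_ge0 ?(ltW Hp) // ler_wpM2l.
  lra.
under eq_bigr do rewrite mulrBr; rewrite sumrB -mulr_suml fdist_sum1 mul1r.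
lra.
Qed.

Lemma comparator_distortion h h' a : phi h = phi h' ->
  comparator k h' a <= comparator k h a + Dl.
Proof.
move=> hh'; have := distortion_ge r01 rho pi a short1 (esym hh').
have := distortion_le short_horizon_ge; rewrite /comparator; lra.
Qed.

(** Both the short optimal value and the floor grow by at most [3/5] of the increase in horizon, and
    [3/5 + 2/3 * 3/5 = 1]: the shift of the tables at a new phase keeps up. *)
Lemma comparatorS h a :
  comparator k.+1 h a <= comparator k h a + (hor k.+1 - H).
Proof.
have HH : H <= hor k.+1 by exact: phase_horizon_le.
have short' : short_horizon k <= short_horizon k.+1 by rewrite /short_horizon; lra.
have s1 := short1; have [g0 g1] := andP (discount_bounds short1).
have [_ g1'] := andP (discount_bounds (le_trans short1 short')).
have gg : discount (short_horizon k) <= discount (short_horizon k.+1).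
  by rewrite /discount lerD2l lerN2 !div1r lef_pV2 // posrE; lra.
have := Qstar_discount_le S0 f r01 rho pi h a g0 gg g1'; rewrite !inv_discount /comparator.
move: (Qstar _ _ _ _ _ _ _) (Qstar _ _ _ _ _ _ _) => q' q Qq.
have floor_le : value_floor k.+1 <= value_floor k + (short_horizon k.+1 - short_horizon k).
  rewrite ge_max addr_ge0 ?value_floor_ge0 ?subr_ge0 //=.
  have := value_floor_ge k; case/andP: lam01 => l0 l1.
  have : lam * (short_horizon k.+1 - short_horizon k) <=
      1 * (short_horizon k.+1 - short_horizon k).
    by rewrite ler_wpM2r // subr_ge0.
  lra.
have : short_horizon k.+1 - short_horizon k = 3 / 5 * (hor k.+1 - H).
  by rewrite /short_horizon mulrBr.
lra.
Qed.

Lemma noise_width_le : 1 + value_range k <= 3 / 5 * H + 1.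
Proof. by rewrite /value_range /short_horizon; have := value_floor_ge0 k; lra. Qed.

Lemma value_range_ge0 : 0 <= value_range k.
Proof. by rewrite subr_ge0 value_floor_le. Qed.

Let H17 : 17 / 3 <= H. Proof. by have := good'; have := tau1; lra. Qed.
Let L1 : 1 <= phase_log R k. Proof. exact/phase_log_ge1/good_phase_gt0. Qed.

Lemma phase_bonus_sqr : phase_bonus R k ^+ 2 = 16 * H ^+ 3 * phase_log R k.
Proof.
have Hp : 0 <= H by have := H17; lra.
have Lp : 0 <= phase_log R k by have := L1; lra.
by rewrite /phase_bonus !exprMn !sqr_sqrtr //; ring.
Qed.

(** With [L] the logarithm, the left side is about [9/25 L H^3] and the right side is [18/25 L H^3];
    [H >= 17/3] absorbs the lower-order terms. *)
Lemma concentration_condition :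
  phase_log R k * (1 + value_range k) ^+ 2 * ((1 + 2 * H) ^+ 2 / (4 * H + 1)) <=
  2 * noise_bound R k ^+ 2.
Proof.
rewrite /noise_bound exprMn phase_bonus_sqr.
have L0 : 0 <= phase_log R k by have := L1; lra.
have H17' := H17.
have w2 : (1 + value_range k) ^+ 2 <= (3 / 5 * H + 1) ^+ 2.
  have := noise_width_le; have := value_range_ge0 => *.
  by rewrite ler_pXn2r ?nnegrE //; lra.
have D0 : 0 < 4 * H + 1 by lra.
rewrite -mulrA [leRHS](_ : _ = phase_log R k * (18 / 25 * H ^+ 3)); last by field.
rewrite ler_wpM2l // mulrA ler_pdivrMr //.
apply: le_trans (ler_wpM2r (sqr_ge0 _) w2) _.
have h2 : 17 / 3 * H <= H ^+ 2 by rewrite expr2 ler_wpM2r //; lra.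
have h3 : 17 / 3 * H ^+ 2 <= H ^+ 3 by rewrite (exprS _ 2) ler_wpM2r ?sqr_ge0.
have h4 : 17 / 3 * H ^+ 3 <= H ^+ 4 by rewrite (exprS _ 3) ler_wpM2r ?exprn_ge0 //; lra.
lra.
Qed.

(** Ensures that the first sample of a cell falls in the large-bonus regime of [cell_invariant]. *)
Lemma bonus_ge_width : 5 / 3 * (1 + value_range k) <= phase_bonus R k.
Proof.
have H17' := H17; have L1' := L1.
have w := noise_width_le; have w0 := value_range_ge0.
rewrite -(@ler_pXn2r _ 2) ?nnegrE ?phase_bonus_ge0 //; last by lra.
rewrite phase_bonus_sqr.
have h2 : 17 / 3 * H <= H ^+ 2 by rewrite expr2 ler_wpM2r //; lra.
have h3 : 17 / 3 * H ^+ 2 <= H ^+ 3 by rewrite (exprS _ 2) ler_wpM2r ?sqr_ge0.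
have h30 : 0 <= H ^+ 3 by rewrite exprn_ge0 //; lra.
have : H ^+ 3 * 1 <= H ^+ 3 * phase_log R k by rewrite ler_wpM2l.
have : (5 / 3 * (1 + value_range k)) ^+ 2 <= (5 / 3 * (3 / 5 * H + 1)) ^+ 2.
  by rewrite ler_pXn2r ?nnegrE //; lra.
lra.
Qed.
End GoodPhase.

Variable X : R.
Hypothesis X_ge : 5 / 3 * tau + 4 <= X.

Let Dl0 : 0 <= Dl.
Proof.
have d0 := distortion_ge0 A_gt0 S0 f r01 rho pi tau1.
exact: le_trans d0 (distortion_le (lexx tau)).
Qed.

Local Notation noise_table := (noise_table S0 f r rho).

(** The comparator is lowered by the distortion accumulated over a horizon and by the deficit [X]
    inherited from uncontrolled phases. *)
Definition excess (k : nat) (Q : S -> A -> R) (h : history A O) (a : A) : R :=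
  Q (phi h) a - (comparator k h a - (hor k * Dl + X)).

(** Asked only in phases with [X < hor k]: in the others the lowered comparator is nonpositive. *)
Definition concentrated (h : history A O) : Prop :=
  let k := phase (size h) in
  good_phase k -> X < hor k -> forall s a, (0 < Ntab (st h) s a)%N ->
  `|noise_table k (short_value k) h s a| <=
    noise_bound R k / Num.sqrt (Ntab (st h) s a)%:R.

Definition always_concentrated (h : history A O) : Prop :=
  forall h1 h2, h = h1 ++ h2 -> concentrated h1.

(** All histories are quantified over, because an entry is shared by every history with the same
    aleatoric state. *)
Definition optimistic (k : nat) (Q : S -> A -> R) (N : S -> A -> nat)
    (E : S -> A -> R) : Prop :=
  forall h a, 0 <= excess k Q h a /\
    (X < hor k -> (0 < N (phi h) a)%N ->
     cell_invariant (1 + value_range k) (phase_bonus R k) (N (phi h) a)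
       (excess k Q h a) (E (phi h) a)).

Lemma excess_trivial k Q h a : good_phase k -> hor k <= X -> 0 <= Q (phi h) a ->
  0 <= excess k Q h a.
Proof.
move=> good HX Q0; have := comparator_le_horizon good h a.
have := value_range_ge0 k; have : 0 <= hor k * Dl.
  by rewrite mulr_ge0 // (le_trans ler01) ?phase_horizon_ge1.
rewrite /excess; lra.
Qed.

(** At a new phase the counts vanish and only nonnegativity of the excess is left. After a good
    phase it follows from [comparatorS]; otherwise the previous horizon is at most [X], and the
    shift of a nonnegative table suffices. *)
Lemma optimistic_prepare h :
  let k := phase (size h) in
  (good_phase k ->
   optimistic k (Qtab (st h)) (Ntab (st h)) (noise_table k (short_value k) h)) ->
  let k' := phase (size h).+1 in
  good_phase k' ->
  optimistic k' (Qtab (prep h)) (Ntab (prep h)) (noise_table k' (short_value k') h).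
Proof.
move=> k opt k' good h' a; rewrite Ntab_prepare -/k -/k'.
have Qprep : excess k' (Qtab (prep h)) h' a =
    excess k (Qtab (st h)) h' a + (hor k' - hor k) -
    (comparator k' h' a - comparator k h' a) + (hor k' - hor k) * Dl.
  by rewrite /excess Qtab_prepare -/k -/k'; ring.
case: (phaseS (size h)) => [E|[E _]]; rewrite -/k -/k' in E.
  move: good Qprep; rewrite E => good ->.
  by rewrite !subrr mul0r !addr0 subr0 eqxx muln1; exact: opt.
rewrite E gtn_eqF // muln0 -E; split=> //.
have HH : hor k <= hor k' by rewrite E; exact: phase_horizon_le.
have [HX|XH] := leP (hor k') X.
  by apply: excess_trivial => //; case/andP: (Qtab_prepare_bounds S0 f r01 h (phi h') a).
have [good_k|bad_k] := boolP (good_phase k).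
  have [exc _] := opt good_k h' a; rewrite Qprep.
  have := comparatorS good_k h' a; rewrite -E => comp.
  have : 0 <= (hor k' - hor k) * Dl by rewrite mulr_ge0 ?subr_ge0.
  lra.
rewrite /excess Qtab_prepare -/k -/k'.
have := comparator_le_horizon good h' a; have := value_range_ge0 k'.
have : 0 <= hor k' * Dl by rewrite mulr_ge0 // (le_trans ler01) ?phase_horizon_ge1.
case/andP: (Qtab_state_bounds S0 f r01 h (phi h') a) => Q0 _.
have XX := X_ge; move: bad_k; rewrite /good_phase -leNgt; lra.
Qed.

Lemma sup_prepare_ge k h h' : good_phase k ->
  (forall a, 0 <= excess k (Qtab (prep h)) h' a) ->
  short_value k h' + 2 / 3 * value_floor k - (hor k * Dl + X) <=
  sup (range (Qtab (prep h) (phi h'))).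
Proof.
move=> good exc; rewrite -lerBrDr -lerBrDr opprK; apply: sup_range_le => // a.
have := exc a; have := le_sup_range (Qtab (prep h) (phi h')) a.
rewrite /excess /comparator; lra.
Qed.

Lemma td_target_ge h ao h' : let k := phase (size h).+1 in good_phase k ->
  (forall h' a, 0 <= excess k (Qtab (prep h)) h' a) -> phi h = phi h' ->
  noise S0 f r rho k (short_value k) h ao + comparator k h' ao.1 - (hor k * Dl + X) <=
  td_target S0 f r h ao.
Proof.
move=> k good exc hh'; rewrite /td_target -/k.
have H1 := phase_horizon_ge1 R k; have H0 : 0 < hor k by lra.
have g0 : 0 <= 1 - (hor k)^-1 by rewrite subr_ge0 invf_le1.
have := ler_wpM2l g0 (sup_prepare_ge good (exc (rcons h ao))).
have := comparator_backup good h ao.1; have := comparator_distortion good ao.1 hh'.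
(* Discounting the deficit by [1/H] frees one [Dl], the price of moving the comparator between
   histories with equal state. *)
have slack : Dl + (1 - (hor k)^-1) * (hor k * Dl + X) <= hor k * Dl + X.
  have -> : (1 - (hor k)^-1) * (hor k * Dl + X) = hor k * Dl + X - Dl - X / hor k.
    by field; rewrite gt_eqF.
  have : 0 <= X / hor k.
    by rewrite divr_ge0 ?(ltW H0) //; have := X_ge; have := tau0; lra.
  lra.
rewrite /noise /backup.
move: slack (sup _) (\sum_o _) (comparator _ _ _) (comparator _ _ _) => slack M B c c'.
lra.
Qed.

Lemma optimistic_step h ao : let k := phase (size h).+1 in good_phase k ->
  (X < hor k -> forall s a, (0 < Ntab (prep h) s a)%N ->
    `|noise_table k (short_value k) h s a| <=
      noise_bound R k / Num.sqrt (Ntab (prep h) s a)%:R) ->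
  concentrated (rcons h ao) ->
  optimistic k (Qtab (prep h)) (Ntab (prep h)) (noise_table k (short_value k) h) ->
  optimistic k (Qtab (st (rcons h ao))) (Ntab (st (rcons h ao)))
    (noise_table k (short_value k) (rcons h ao)).
Proof.
move=> k good conc conc' opt h' a.
have exc h2 a2 : 0 <= excess k (Qtab (prep h)) h2 a2 by case: (opt h2 a2).
have H1 := phase_horizon_ge1 R k; have H0 : 0 < hor k by lra.
have [HX|XH] := leP (hor k) X.
  split=> //; apply: excess_trivial => //.
  have := Qtab_state_bounds S0 f r01 (rcons h ao) (phi h') a.
  by case/andP.
have := opt h' a; have conc_h := conc XH (phi h') a.
have := conc' ; rewrite /concentrated size_rcons -/k => /(_ good XH (phi h') a).
rewrite /excess Qtab_rcons Ntab_rcons -/k.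
rewrite /noise_table hist_rec_rcons -/(noise_table k (short_value k)) /noise_step.
case: ifP => [/andP[/eqP sE /eqP aE]|_]; last first.
  by rewrite addn0 => _ [D0 inv]; split=> // _; exact: inv.
rewrite addn1 => /(_ isT) E'b [D0 inv].
set n := Ntab _ _ _ in conc_h E'b inv *.
set D := Qtab _ _ _ - _ in D0 inv.
have width0 : 0 < 1 + value_range k by have := value_range_ge0 k; lra.
have wC : 2 / 3 * (1 + value_range k) <=
    hor k - (comparator k h' a - (hor k * Dl + X)).
  have := comparator_le_horizon good h' a; have : 0 <= hor k * Dl.
    by rewrite mulr_ge0 // ltW.
  have := X_ge; have := tau0; lra.
have noise_w : `|noise S0 f r rho k (short_value k) h ao| <= 1 + value_range k.
  by apply: noise_le => //; exact: short_value_bounds.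
have noise_b : noise_bound R k = 3 / 20 * phase_bonus R k by [].
rewrite noise_b in conc_h E'b.
have target := td_target_ge ao good exc (esym sE); rewrite -aE in target.
set al := learning_rate _ _ in E'b *.
set b := phase_bonus R k / _; set x := noise _ _ _ _ _ _ _ _ in noise_w E'b target *.
set c := comparator k h' a - _ in wC *.
have DE : D = Qtab (prep h) (phi h') a - c by [].
set D' := Num.min _ _ - c.
have D'ge : Num.min ((1 - al) * D + al * (x + b)) (hor k - c) <= D'.
  rewrite lerBrDr le_min -!lerBrDr !ge_min lexx orbT andbT; apply/orP; left.
  have al0 : 0 <= al by case/andP: (learning_rate01 n H0).
  have tgt : x + c <= td_target S0 f r h ao by rewrite addrA.
  have := ler_wpM2l al0 tgt; rewrite DE; clearbody al b x c; lra.
have [D'0 inv'] := cell_invariantS H0 width0 (bonus_ge_width good) wC noise_w D0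
  (inv XH) conc_h E'b D'ge.
by split.
Qed.

Lemma table_optimistic h : always_concentrated h -> let k := phase (size h) in
  good_phase k ->
  optimistic k (Qtab (st h)) (Ntab (st h)) (noise_table k (short_value k) h).
Proof.
elim/last_ind: h => [|h ao IHh] conc.
  by move=> k /good_phase_gt0; rewrite /k phase0.
have conc_h : always_concentrated h.
  by move=> h1 h2 E; apply: (conc h1 (rcons h2 ao)); rewrite E rcons_cat.
have opt := optimistic_prepare (IHh conc_h).
rewrite size_rcons => k good; apply: optimistic_step => //; last 2 first.
- by apply: (conc _ [::]); rewrite cats0.
- exact: opt.
rewrite -/k => XH s a; rewrite Ntab_prepare -/k.
case: eqP => [E|_]; last by rewrite muln0.
rewrite muln1 => N0; have := conc_h h [::]; rewrite cats0 => /(_ erefl).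
by rewrite /concentrated -E; exact.
Qed.

Lemma prepared_excess_ge0 h : always_concentrated h -> good_phase (phase (size h).+1) ->
  forall h' a, 0 <= excess (phase (size h).+1) (Qtab (prep h)) h' a.
Proof.
by move=> conc good h' a; case: (optimistic_prepare (table_optimistic conc) good h' a).
Qed.
End Optimism.

(** * Accounting for the collected reward *)

Section CellAccounting.
Variable R : realType.

Lemma sum_update (I : finType) (F G : I -> R) (i : I) :
  (forall j, j != i -> F j = G j) -> \sum_j F j = \sum_j G j + (F i - G i).
Proof.
move=> FG; rewrite (bigD1 i) // [X in _ = X + _](bigD1 i) //=.
rewrite (eq_bigr G) => [|j]; last exact: FG.
ring.
Qed.

Lemma sqrt_increment (n : nat) :
  (2 * Num.sqrt n.+1%:R)^-1 <= Num.sqrt n.+1%:R - Num.sqrt n%:R :> R.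
Proof.
set q : R := Num.sqrt n.+1%:R; set p : R := Num.sqrt n%:R.
have q0 : 0 < q by rewrite sqrtr_gt0 ltr0n.
have q2 : q ^+ 2 = p ^+ 2 + 1 by rewrite !sqr_sqrtr ?ler0n // natr1.
rewrite -div1r ler_pdivrMr ?mulr_gt0 //.
have := sqr_ge0 (q - p); lra.
Qed.

(* The potential [(n / 2H + 1) q] of a cell absorbs the weights of the update:
   [n + 1 + 2H] times the rate is [1 + 2H]. *)
Lemma cell_potential (H q q' z : R) (n : nat) :
  let al := learning_rate H n.+1 in 0 < H -> q' <= (1 - al) * q + al * z ->
  (n.+1%:R / (2 * H) + 1) * q' - (n%:R / (2 * H) + 1) * q <=
  (1 + (2 * H)^-1) * z - q.
Proof.
move=> al H0 q'le; have nH : 0 < n%:R + 1 + 2 * H.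
  by rewrite ltr_wpDl // ?mulr_gt0 // addr_ge0.
have Hn : H != 0 by rewrite gt_eqF.
have c0 : 0 <= (n%:R + 1 + 2 * H) / (2 * H) by rewrite divr_ge0 ?ltW // mulr_gt0.
have := ler_wpM2l c0 q'le; rewrite /al /learning_rate -(natr1 n).
have -> : (n%:R + 1 + 2 * H) / (2 * H) *
    ((1 - (1 + 2 * H) / (n%:R + 1 + 2 * H)) * q +
     (1 + 2 * H) / (n%:R + 1 + 2 * H) * z) =
    n%:R / (2 * H) * q + (1 + (2 * H)^-1) * z.
  by field; rewrite Hn gt_eqF.
have -> : (n%:R + 1 + 2 * H) / (2 * H) * q' = ((n%:R + 1) / (2 * H) + 1) * q'.
  by field.
lra.
Qed.

(** An update lowers an entry by at most the rate times the horizon; this charges that loss to the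
    bonus. *)
Lemma learning_rate_bonus (k n : nat) : 17 / 3 <= phase_horizon R k -> (0 < k)%N ->
  learning_rate (phase_horizon R k) n.+1 * phase_horizon R k <=
  2 / 5 * (phase_bonus R k / Num.sqrt n.+1%:R).
Proof.
move=> H17 k0; have L1 := phase_log_ge1 R k0.
have L0 : 0 <= phase_log R k by lra.
have b2 : phase_bonus R k ^+ 2 = 16 * phase_horizon R k ^+ 3 * phase_log R k.
  have Hp : 0 <= phase_horizon R k by lra.
  by rewrite /phase_bonus !exprMn !sqr_sqrtr //; ring.
set H := phase_horizon R k in H17 b2 *.
have n1 : 1 <= n.+1%:R :> R by rewrite ler1n.
have sq0 : 0 < Num.sqrt n.+1%:R :> R by rewrite sqrtr_gt0; lra.
have nH : 0 < n.+1%:R + 2 * H by lra.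
have lhs0 : 0 <= learning_rate H n.+1 * H.
  by rewrite /learning_rate mulr_ge0 ?divr_ge0 //; lra.
have rhs0 : 0 <= 2 / 5 * (phase_bonus R k / Num.sqrt n.+1%:R).
  apply: mulr_ge0; first by lra.
  by apply: divr_ge0; [exact: phase_bonus_ge0|exact: ltW].
rewrite -(@ler_pXn2r _ 2) ?nnegrE //.
rewrite [leLHS]exprMn [leRHS]exprMn [X in _ <= _ * X]exprMn exprVn b2.
rewrite sqr_sqrtr ?ler0n // /learning_rate expr_div_n.
have a2 : (1 + 2 * H) ^+ 2 / (n.+1%:R + 2 * H) ^+ 2 <= (1 + 2 * H) / n.+1%:R.
  rewrite ler_pdivrMr ?exprn_gt0 // mulrAC ler_pdivlMr; last by lra.
  rewrite expr2 -!mulrA ler_pM2l; last by lra.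
  set x : R := n.+1%:R in n1 nH *; clearbody x H.
  have : 0 <= (x - 1) * x by apply: mulr_ge0; lra.
  have : 0 <= H * x by apply: mulr_ge0; lra.
  have := sqr_ge0 H; lra.
apply: le_trans (ler_wpM2r (sqr_ge0 H) a2) _.
rewrite mulrAC [leRHS]mulrA ler_wpM2r ?invr_ge0 //.
have h3 : 17 / 3 * H ^+ 2 <= H ^+ 3 by rewrite (exprS _ 2) ler_wpM2r ?sqr_ge0.
have h30 : 0 <= H ^+ 3 by rewrite exprn_ge0 //; lra.
have : H ^+ 3 * 1 <= H ^+ 3 * phase_log R k by rewrite ler_wpM2l.
lra.
Qed.

Lemma phase_horizon_ratio k : 8 / 7 * phase_horizon R k <= phase_horizon R k.+1.
Proof.
have /andP[w1 w2] := fifth_root2 R.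
case: k => [|k]; last first.
  by rewrite phase_horizonS ler_wpM2r // (le_trans ler01) ?phase_horizon_ge1.
rewrite phase_horizon0 mulr1; apply: le_trans w1 _.
by rewrite /phase_horizon ge0_ler_powR ?nnegrE // ler_nat.
Qed.
End CellAccounting.

Section PathRegret.
Variables (R : realType) (A O S : finType) (A_gt0 : (0 < #|A|)%N).
Variables (S0 : S) (f : S -> A -> O -> S) (r : S -> A -> O -> R).
Hypothesis r01 : forall s a o, 0 <= r s a o <= 1.
Variables (rho : environment R A O) (pi : policy R A O) (tau Dl : R).
Hypothesis tau1 : 1 <= tau.
Hypothesis pi_tau : policies_within S0 f r rho tau pi.
Hypothesis distortion_le :
  forall tau' : R, tau <= tau' -> distortion S0 f r rho tau' <= Dl.
Variable X : R.
Hypothesis X_ge : 5 / 3 * tau + 4 <= X.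
Local Notation phi := (phi S0 f).
Local Notation st := (state_after S0 f r).
Local Notation prep h := (prepare (st h)).
Local Notation hor := (phase_horizon R).
Local Notation lam := (avg_reward S0 f r rho pi).
Local Notation good k := (good_phase tau k).
Local Notation value_floor := (value_floor S0 f r rho pi tau).
Local Notation always_concentrated := (always_concentrated S0 f r rho tau X).

Let Dl0 : 0 <= Dl.
Proof.
have d0 := distortion_ge0 A_gt0 S0 f r01 rho pi tau1.
exact: le_trans d0 (distortion_le (lexx tau)).
Qed.

(** A lower bound for the state values in optimistic tables, close to [lam * hor k] since [5/3] of
    the short horizon is the horizon. *)
Definition table_floor (k : nat) : R :=
  Num.max 0 (5 / 3 * value_floor k - (hor k * Dl + X)).

Definition surplus (k : nat) (q : R) : R :=
  Num.max 0 (q - (1 - (hor k)^-1) * table_floor k).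

(** The cell terms absorb the update weights, the square roots grow with the bonuses paid, and the
    value of the current state telescopes along a greedy path. *)
Definition potential (k : nat) (Q : S -> A -> R) (N : S -> A -> nat) (s : S) : R :=
  \sum_(p : S * A) ((N p.1 p.2)%:R / (2 * hor k) + 1) * surplus k (Q p.1 p.2) -
  3 * phase_bonus R k * \sum_(p : S * A) Num.sqrt (N p.1 p.2)%:R -
  sup (range (Q s)).

Let hor0 k : 0 < hor k.
Proof. exact: lt_le_trans (phase_horizon_ge1 R k). Qed.

Lemma table_floor_ge0 k : 0 <= table_floor k.
Proof. by rewrite le_max lexx. Qed.

Lemma surplus_ge0 k q : 0 <= surplus k q.
Proof. by rewrite le_max lexx. Qed.

Lemma surplus_ge k q : q - (1 - (hor k)^-1) * table_floor k <= surplus k q.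
Proof. by rewrite le_max lexx orbT. Qed.

Lemma surplus_le k q : 0 <= q <= hor k -> surplus k q <= hor k.
Proof.
move=> /andP[q0 qH]; rewrite ge_max (ltW (hor0 k)) /= (le_trans _ qH) // gerBl.
by rewrite mulr_ge0 ?table_floor_ge0 // subr_ge0 invf_le1 // phase_horizon_ge1.
Qed.

Lemma avg_reward_le_table_floor k :
  lam - table_floor k / hor k <= (5 / 3 * tau + X) / hor k + Dl.
Proof.
have H0 := hor0 k; have Hn : hor k != 0 by rewrite gt_eqF.
have ge : 5 / 3 * value_floor k - (hor k * Dl + X) <= table_floor k.
  by rewrite le_max lexx orbT.
have := value_floor_ge S0 f r rho pi tau k; rewrite /short_horizon => fl.
have : lam * hor k - 5 / 3 * tau - (hor k * Dl + X) <= table_floor k by lra.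
rewrite -(ler_pM2r (_ : 0 < (hor k)^-1)) ?invr_gt0 //.
have -> : (lam * hor k - 5 / 3 * tau - (hor k * Dl + X)) / hor k =
    lam - (5 / 3 * tau + X) / hor k - Dl by field.
lra.
Qed.

Definition greedy (h : history A O) : Prop := forall h1 ao h2,
  h = rcons h1 ao ++ h2 -> ao.1 \in argmaxset (Qtab (prep h1) (phi h1)).

(** Greediness identifies the current value [V] with the updated entry, so [cell_potential]
    exchanges [V] for the reward, the bonus and the next value above the floor. Discounting the
    floor in [surplus] leaves [table_floor k / hor k] per step. *)
Lemma potential_step h ao : let k := phase (size h).+1 in good k ->
  always_concentrated h -> ao.1 \in argmaxset (Qtab (prep h) (phi h)) ->
  potential k (Qtab (st (rcons h ao))) (Ntab (st (rcons h ao))) (phi (rcons h ao)) +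
    (table_floor k / hor k - r (phi h) ao.1 ao.2) <=
  potential k (Qtab (prep h)) (Ntab (prep h)) (phi h) + (2 * hor k)^-1.
Proof.
move=> k good conc greedy_ao.
have exc : forall h' a, 0 <= excess S0 f r rho pi tau Dl X k (Qtab (prep h)) h' a.
  exact: prepared_excess_ge0.
set s := phi h; set a := ao.1; set s' := phi (rcons h ao).
set Q := Qtab (prep h); set Q' := Qtab (st _); set N := Ntab (prep h); set N' := Ntab (st _).
have H0 := hor0 k; have c0 := table_floor_ge0 k.
have H17 : 17 / 3 <= hor k.
  by move: good; rewrite /good_phase; have := tau1; lra.
have N'E p : N' p.1 p.2 = (N p.1 p.2 + (p == (s, a)))%N.
  by rewrite /N' Ntab_rcons; case: p => s1 a1; rewrite xpair_eqE.
have Q'E p : p != (s, a) -> Q' p.1 p.2 = Q p.1 p.2.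
  by case: p => s1 a1 /=; rewrite xpair_eqE /Q' Qtab_rcons => /negbTE ->.
set n := N s a.
have N'sa : N' s a = n.+1 by rewrite (N'E (s, a)) eqxx addn1.
pose al := learning_rate (hor k) n.+1.
have /andP[al0 al1] : 0 <= al <= 1 by exact: learning_rate01.
pose b := phase_bonus R k / Num.sqrt n.+1%:R.
have b0 : 0 <= b by apply: divr_ge0; [exact: phase_bonus_ge0|exact: sqrtr_ge0].
pose V := sup (range (Q s)); pose V' := sup (range (Q s')).
pose V'' := sup (range (Q' s')).
have Q0H s1 a1 : 0 <= Q s1 a1 <= hor k by exact: Qtab_prepare_bounds.
have Q'sa : Q' s a =
    Num.min ((1 - al) * Q s a + al * (r s a ao.2 + (1 - (hor k)^-1) * V' + b)) (hor k).
  by rewrite /Q' Qtab_rcons !eqxx.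
have [r0 r1] := andP (r01 s a ao.2).
have VQ : V = Q s a by exact: sup_range_argmax.
have g0 : 0 <= 1 - (hor k)^-1 by rewrite subr_ge0 invf_le1 // phase_horizon_ge1.
have V'0 : 0 <= V' by apply: le_trans (le_sup_range _ a); case/andP: (Q0H s' a).
have V'c : table_floor k <= V'.
  rewrite ge_max V'0 /=.
  have := sup_prepare_ge A_gt0 good (exc (rcons h ao)).
  have := short_value_bounds A_gt0 r01 tau1 pi_tau good (rcons h ao).
  by move=> /andP[u_ge _]; rewrite -/s' -/Q -/V'; lra.
(* The target reads the next state before the update, the potential after it; they differ only if
   the updated entry belongs to the next state. *)
have drop : V' <= V'' + al * hor k.
  apply: sup_range_le => // a1; have le'' := le_sup_range (Q' s') a1.
  have alH : 0 <= al * hor k by rewrite mulr_ge0 // ltW.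
  have [E|ne] := eqVneq (s', a1) (s, a); last first.
    by rewrite -(Q'E (s', a1)) //= (le_trans le'') // lerDl.
  case: E => Es Ea; rewrite Es Ea in le'' *.
  apply: le_trans (_ : Q' s a + al * hor k <= _); last first.
    by rewrite lerD2r /V'' Es.
  have [Qsa0 QsaH] := andP (Q0H s a).
  rewrite -lerBlDr Q'sa le_min; apply/andP; split; last by lra.
  have : 0 <= al * (r s a ao.2 + (1 - (hor k)^-1) * V' + b).
    by rewrite mulr_ge0 // !addr_ge0 // mulr_ge0.
  have := ler_wpM2l al0 QsaH; lra.
pose z := r s a ao.2 + b + (1 - (hor k)^-1) * (V' - table_floor k).
have z0 : 0 <= z by rewrite !addr_ge0 // mulr_ge0 // subr_ge0.
have surplus_le' : surplus k (Q' s a) <= (1 - al) * surplus k (Q s a) + al * z.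
  have al1' : 0 <= 1 - al by rewrite subr_ge0.
  have rhs0 : 0 <= (1 - al) * surplus k (Q s a) + al * z.
    by apply: addr_ge0; apply: mulr_ge0 => //; exact: surplus_ge0.
  rewrite ge_max rhs0 /=.
  have := ler_wpM2l al1' (surplus_ge k (Q s a)).
  have : Q' s a <= (1 - al) * Q s a + al * (r s a ao.2 + (1 - (hor k)^-1) * V' + b).
    by rewrite Q'sa ge_min lexx.
  rewrite /z; lra.
have cell := cell_potential H0 surplus_le'.
have sum1 := sum_update
  (F := fun p : S * A => ((N' p.1 p.2)%:R / (2 * hor k) + 1) * surplus k (Q' p.1 p.2))
  (G := fun p : S * A => ((N p.1 p.2)%:R / (2 * hor k) + 1) * surplus k (Q p.1 p.2))
  (i := (s, a)).
have sum2 := sum_update (F := fun p : S * A => Num.sqrt (N' p.1 p.2)%:R : R)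
  (G := fun p : S * A => Num.sqrt (N p.1 p.2)%:R : R) (i := (s, a)).
rewrite /potential sum1 => [|p ne]; last by rewrite Q'E // N'E (negbTE ne) addn0.
rewrite sum2 => [|p ne]; last by rewrite N'E (negbTE ne) addn0.
rewrite /= N'sa -/n -/V -/V''.
(* The bonus budget: the target uses [(1 + 1/10) b] and [drop] uses [2/5 b], which add up to the
   [3/2 b] provided by the square roots. *)
have rate := learning_rate_bonus n H17 (good_phase_gt0 tau1 good).
have bE : 3 / 2 * b <= 3 * phase_bonus R k * (Num.sqrt n.+1%:R - Num.sqrt n%:R).
  have := ler_wpM2l (phase_bonus_ge0 R k) (sqrt_increment R n).
  rewrite invfM mulrCA -/b; lra.
have sV : V - (1 - (hor k)^-1) * table_floor k <= surplus k (Q s a).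
  by rewrite VQ; exact: surplus_ge.
have kappa : (1 + (2 * hor k)^-1) * ((1 - (hor k)^-1) * (V' - table_floor k)) <=
    V' - table_floor k.
  rewrite mulrA ler_piMl ?subr_ge0 //.
  have -> : (1 + (2 * hor k)^-1) * (1 - (hor k)^-1) =
      1 - ((hor k)^-1 + (hor k)^-1 * (hor k)^-1) / 2 by field; rewrite gt_eqF.
  by rewrite gerBl divr_ge0 // addr_ge0 ?mulr_ge0 ?invr_ge0 // ltW.
have invH : (2 * hor k)^-1 <= 1 / 10.
  by rewrite -div1r ler_pdivrMr ?mulr_gt0 //; lra.
have invH0 : 0 <= (2 * hor k)^-1 by rewrite invr_ge0 mulr_ge0 // ltW.
have rb : (2 * hor k)^-1 * (r s a ao.2) <= (2 * hor k)^-1.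
  by rewrite ler_piMr.
have bb := ler_wpM2r b0 invH.
have tE : table_floor k / hor k = table_floor k - (1 - (hor k)^-1) * table_floor k by ring.
rewrite -/al -/b in rate.
move: cell; rewrite -/al /z tE.
move: (\sum_p _ * _) (\sum_p Num.sqrt _) => S1 S2.
move: (_ * surplus k (Q' s a)) (_ * surplus k (Q s a)) => q1 q2.
rewrite [3 * _ * (S2 + _)]mulrDr.
move: bE; move: (3 * phase_bonus R k * (Num.sqrt n.+1%:R - Num.sqrt n%:R)).
move: (3 * phase_bonus R k * S2) => d2 d1.
lra.
Qed.

Local Notation cells := (#|S|%:R * #|A|%:R : R).

(** Cauchy-Schwarz over the cells: [hor k] to the power [5/2] is the square root of the change
    point. *)
Lemma sum_sqrt_count_le k (N : S -> A -> nat) :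
  (\sum_(p : S * A) N p.1 p.2 <= change_point k)%N ->
  \sum_(p : S * A) Num.sqrt (N p.1 p.2)%:R <=
    Num.sqrt cells * (hor k ^+ 2 * Num.sqrt (hor k)).
Proof.
move=> Nk; have H0 := hor0 k.
have S0_gt : (0 < #|S|)%N by apply/card_gt0P; exists S0.
have cells0 : 0 < cells by rewrite mulr_gt0 // ltr0n.
set D := Num.sqrt cells; set M := hor k ^+ 2 * Num.sqrt (hor k).
have D0 : 0 < D by rewrite sqrtr_gt0.
have M0 : 0 < M by rewrite mulr_gt0 ?exprn_gt0 // sqrtr_gt0.
have M2 : M ^+ 2 = (change_point k)%:R.
  by rewrite exprMn sqr_sqrtr ?ltW // -phase_horizon5; ring.
have D2 : D ^+ 2 = cells by rewrite sqr_sqrtr // ltW.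
(* AM-GM *)
have amgm (n : nat) : Num.sqrt n%:R <= D / (2 * M) * n%:R + M / (2 * D).
  rewrite -[in X in _ * X](sqr_sqrtr (ler0n R n)); set x := Num.sqrt _.
  have c : 0 < 2 * M * D by do 2![apply: mulr_gt0 => //].
  rewrite -(ler_pM2l c).
  have -> : 2 * M * D * (D / (2 * M) * x ^+ 2 + M / (2 * D)) = (D * x) ^+ 2 + M ^+ 2.
    by field; rewrite !gt_eqF.
  by have := sqr_ge0 (D * x - M); lra.
apply: le_trans (ler_sum _ (fun p _ => amgm (N p.1 p.2))) _.
rewrite big_split -mulr_sumr -natr_sum /= sumr_const card_prod.
have : (\sum_(p : S * A) N p.1 p.2)%:R <= M ^+ 2 by rewrite M2 ler_nat.
have c : 0 <= D / (2 * M) by rewrite divr_ge0 ?mulr_ge0 // ltW.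
move=> /(ler_wpM2l c).
have -> : D / (2 * M) * M ^+ 2 = D * M / 2 by field; rewrite gt_eqF.
have -> : M / (2 * D) *+ (#|S| * #|A|) = D * M / 2.
  by rewrite -mulr_natr natrM -D2; field; rewrite gt_eqF.
lra.
Qed.

Lemma potential_ge k Q N s :
  (\sum_(p : S * A) N p.1 p.2 <= change_point k)%N ->
  (forall s a, Q s a <= hor k) ->
  - hor k - 12 * Num.sqrt cells * Num.sqrt (phase_log R k) * hor k ^+ 4 <=
  potential k Q N s.
Proof.
move=> Nk QH; have H0 := hor0 k; rewrite /potential.
have := ler_wpM2l (phase_bonus_ge0 R k) (sum_sqrt_count_le Nk).
have -> : phase_bonus R k * (Num.sqrt cells * (hor k ^+ 2 * Num.sqrt (hor k))) =
    4 * Num.sqrt cells * Num.sqrt (phase_log R k) * hor k ^+ 3 * Num.sqrt (hor k) ^+ 2.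
  by rewrite /phase_bonus; ring.
rewrite sqr_sqrtr ?(ltW H0) //.
have : sup (range (Q s)) <= hor k by exact: sup_range_le.
have : 0 <= \sum_(p : S * A)
    ((N p.1 p.2)%:R / (2 * hor k) + 1) * surplus k (Q p.1 p.2).
  apply: sumr_ge0 => p _; rewrite mulr_ge0 ?surplus_ge0 // addr_ge0 //.
  by rewrite divr_ge0 ?ler0n // mulr_ge0 // ltW.
lra.
Qed.

Lemma potential_start_le k Q s : (forall s a, 0 <= Q s a <= hor k) ->
  potential k Q (fun _ _ => 0%N) s <= cells * hor k.
Proof.
move=> QH; rewrite /potential [X in _ - _ * X - _]big1 => [|p _]; last by rewrite sqrtr0.
rewrite mulr0 subr0.
have : 0 <= sup (range (Q s)).
  have /card_gt0P[a _] := A_gt0.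
  by apply: le_trans (le_sup_range _ a); case/andP: (QH s a).
suff : \sum_(p : S * A) ((0%N)%:R / (2 * hor k) + 1) * surplus k (Q p.1 p.2) <= cells * hor k.
  by move: (\sum_p _) (sup _) => *; lra.
apply: (@le_trans _ _ (\sum_(p : S * A) hor k)).
  by apply: ler_sum => p _; rewrite mul0r add0r mul1r surplus_le.
by rewrite sumr_const card_prod -natrM mulr_natl.
Qed.

Definition total_reward : history A O -> R :=
  hist_rec (fun h x ao => x + r (phi h) ao.1 ao.2) 0.

(** The term [12/5] pays for phase 0; the rest turns a cost per step of order [1 / hor k] into
    increments of [t^(4/5)]. *)
Definition stage_coef : R := 12 / 5 + 3 / 2 * (5 / 3 * tau + X + 1 / 2).

(** The constants make the costs of phase changes telescope: [18 + 12 = 18 * 5/3] with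
    [5/3 <= (8/7)^4], and [16 + 1 <= (16 - 1) * 8/7]. *)
Definition phase_cost (LT : R) (k : nat) : R :=
  18 * Num.sqrt cells * Num.sqrt LT * hor k ^+ 4 + 16 * cells * hor k.

Let cells1 : 1 <= cells.
Proof.
have S_gt0 : (0 < #|S|)%N by apply/card_gt0P; exists S0.
by rewrite -natrM ler1n muln_gt0 S_gt0.
Qed.

Lemma phase_cost_le LT j k : (j <= k)%N -> phase_cost LT j <= phase_cost LT k.
Proof.
move=> jk; have H0 := hor0 j; have Hjk : hor j <= hor k by exact: phase_horizon_le.
rewrite /phase_cost lerD //.
  rewrite ler_wpM2l ?mulr_ge0 ?sqrtr_ge0 //.
  by rewrite lerXn2r ?nnegrE ?(ltW H0) ?(ltW (hor0 k)).
by rewrite ler_wpM2l // mulr_ge0 // (le_trans ler01).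
Qed.

Lemma phase_costS LT k :
  phase_cost LT k + hor k + 12 * Num.sqrt cells * Num.sqrt LT * hor k ^+ 4 +
    cells * hor k.+1 <= phase_cost LT k.+1.
Proof.
have H0 := hor0 k; have ratio := phase_horizon_ratio R k; have C1 := cells1.
have D0 : 0 <= Num.sqrt cells * Num.sqrt LT by rewrite mulr_ge0 ?sqrtr_ge0.
have H4 : 5 / 3 * hor k ^+ 4 <= hor k.+1 ^+ 4.
  apply: (@le_trans _ _ ((8 / 7 * hor k) ^+ 4)).
    by rewrite exprMn ler_wpM2r ?exprn_ge0 ?ltW //; lra.
  by rewrite lerXn2r ?nnegrE ?mulr_ge0 // ltW.
rewrite /phase_cost; have := ler_wpM2l D0 H4.
have : hor k <= cells * hor k by rewrite ler_peMl // ltW.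
have : cells * (8 / 7 * hor k) <= cells * hor k.+1 by rewrite ler_wpM2l // (le_trans ler01).
move: (Num.sqrt cells) (Num.sqrt LT) (cells) => D l c.
lra.
Qed.

Lemma stage_cost t :
  let k := phase t.+1 in let d := t.+1%:R `^ (4 / 5) - t%:R `^ (4 / 5) in
  [/\ 0 <= d, ~~ good k -> 1 <= stage_coef * d &
      good k -> (5 / 3 * tau + X) / hor k + (2 * hor k)^-1 <= stage_coef * d].
Proof.
move=> k d; have t1' := tau1; have X' := X_ge.
have d0 : 0 <= d by rewrite subr_ge0 ge0_ler_powR ?nnegrE ?ler_nat //; lra.
have coef0 : 0 <= 3 / 2 * (5 / 3 * tau + X + 1 / 2) by lra.
have [k0|k_gt0] := posnP k.
  have small : 1 <= 12 / 5 * d.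
    (* Phase 0 ends before time 20, and [19 <= 2 * (8/5)^5]. *)
    have /(four_fifths_increment (_ : 0 < 8 / 5)) : t.+1%:R <= 2 * (8 / 5 : R) ^+ 5.
      apply: (@le_trans _ _ 19); last by lra.
      by rewrite ler_nat -ltnS; have := phase_lt t.+1; rewrite -/k k0.
    rewrite -/d invf_div => /(_ _); lra.
  split=> // [_|/(good_phase_gt0 tau1)]; last by rewrite k0.
  have := mulr_ge0 coef0 d0; rewrite /stage_coef; lra.
have inc : (hor k)^-1 <= 3 / 2 * d.
  apply: four_fifths_increment => //; rewrite phase_horizon5 -natrM ler_nat.
  by have := phase_lt t.+1; rewrite -/k; case: (k) k_gt0 => // j _; rewrite change_pointS => /ltnW.
have iH : 0 <= (hor k)^-1 by rewrite invr_ge0 ltW.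
split=> // [bad|_].
  have HX : hor k <= X by move: bad; rewrite /good_phase -leNgt; lra.
  have : 1 <= X * (3 / 2 * d).
    apply: (@le_trans _ _ (X * (hor k)^-1)); first by rewrite ler_pdivlMr // mul1r.
    by rewrite ler_wpM2l //; lra.
  have : 0 <= (12 / 5 + 3 / 2 * (5 / 3 * tau + 1 / 2)) * d by rewrite mulr_ge0 //; lra.
  rewrite /stage_coef; lra.
have c0 : 0 <= 5 / 3 * tau + X + 1 / 2 by lra.
have := ler_wpM2l c0 inc; rewrite invfM /stage_coef; lra.
Qed.

(** Induction along the path. A step outside good phases costs at most 1, a step inside is bounded
    by [potential_step], and [phase_costS] pays for replacing the potential when a phase changes. *)
Lemma path_regret h (LT : R) : always_concentrated h -> greedy h ->
  (forall j, (j <= phase (size h))%N -> phase_log R j <= LT) ->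
  lam * (size h)%:R - total_reward h +
    (if good (phase (size h)) then
       potential (phase (size h)) (Qtab (st h)) (Ntab (st h)) (phi h) else 0) <=
  stage_coef * (size h)%:R `^ (4 / 5) + Dl * (size h)%:R +
    phase_cost LT (phase (size h)).
Proof.
have t1' := tau1; have X' := X_ge.
have coef0 : 0 <= stage_coef by rewrite /stage_coef; lra.
elim/last_ind: h => [|h ao IHh] conc grd logs.
  set k := phase _; have -> : good k = false.
    by apply/negP => /(good_phase_gt0 tau1); rewrite /k phase0.
  rewrite mulr0 mulr0 subr0 addr0 addr_ge0 //; first by rewrite addr0 mulr_ge0 ?powR_ge0.
  have H0 := hor0 k; rewrite /phase_cost addr_ge0 // ?mulr_ge0 ?sqrtr_ge0 ?exprn_ge0 ?(ltW H0) //.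
have conc_h : always_concentrated h.
  by move=> h1 h2 E; apply: (conc h1 (rcons h2 ao)); rewrite E rcons_cat.
have grd_h : greedy h.
  by move=> h1 b h2 E; apply: (grd h1 b (rcons h2 ao)); rewrite E rcons_cat.
have ao_max : ao.1 \in argmaxset (Qtab (prep h) (phi h)).
  by apply: (grd h ao [::]); rewrite cats0.
rewrite size_rcons in logs *; set t := size h in logs *; set k := phase t.+1 in logs *.
have le_phase : (phase t <= k)%N by exact: leq_phase.
have logs_h j : (j <= phase t)%N -> phase_log R j <= LT.
  by move=> jt; apply: logs; exact: leq_trans le_phase.
have := IHh conc_h grd_h logs_h; rewrite -/t => {}IHh.
have totE : total_reward (rcons h ao) = total_reward h + r (phi h) ao.1 ao.2.
  by rewrite /total_reward hist_rec_rcons.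
have [r0 r1] := andP (r01 (phi h) ao.1 ao.2).
have [l0 l1] := andP (avg_reward_01 r01 pi_tau).
have [d0 bad_cost good_cost] := stage_cost t.
set d := _ - _ in d0 bad_cost good_cost.
have tE : t.+1%:R `^ (4 / 5) = t%:R `^ (4 / 5) + d by rewrite /d addrC subrK.
rewrite totE {}tE -(natr1 t); clearbody d; rewrite !mulrDr !mulr1.
case: ifPn => [good_k|bad_k]; last first.
  have bad_t : ~~ good (phase t).
    apply: contra bad_k => g; apply: lt_le_trans g _; exact: phase_horizon_le.
  rewrite ifN // addr0 in IHh; rewrite addr0.
  have := bad_cost bad_k; have := phase_cost_le LT le_phase; have := Dl0; lra.
(* The potential is moved to the prepared tables: unchanged within a phase, restarted with zero
   counts at a new one. *)
have start : lam * t%:R - total_reward h +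
    potential k (Qtab (prep h)) (Ntab (prep h)) (phi h) <=
    stage_coef * t%:R `^ (4 / 5) + Dl * t%:R + phase_cost LT k.
  have [E|[E _]] := phaseS t; rewrite -/k in E.
    rewrite -E good_k in IHh.
    have -> : Qtab (prep h) = Qtab (st h).
      by apply/funext => s; apply/funext => a; rewrite Qtab_prepare -/t -/k E subrr addr0.
    have -> : Ntab (prep h) = Ntab (st h).
      by apply/funext => s; apply/funext => a; rewrite Ntab_prepare -/t -/k E eqxx muln1.
    exact: IHh.
  have -> : Ntab (prep h) = fun _ _ => 0%N.
    apply/funext => s; apply/funext => a.
    by rewrite Ntab_prepare -/t -/k E gtn_eqF // muln0.
  have := potential_start_le (phi h) (Qtab_prepare_bounds S0 f r01 h).
  rewrite -/t -/k => start0; have := phase_costS LT (phase t); rewrite -E.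
  have H0 := hor0 (phase t).
  have D0 : 0 <= Num.sqrt cells * hor (phase t) ^+ 4.
    by rewrite mulr_ge0 ?sqrtr_ge0 ?exprn_ge0 // ltW.
  have [good_t|bad_t] := boolP (good (phase t)).
    rewrite ifT // in IHh.
    have t_gt0 : (0 < phase t)%N by exact: good_phase_gt0 good_t.
    have QH s a : Qtab (st h) s a <= hor (phase t).
      by case/andP: (Qtab_state_bounds S0 f r01 h s a).
    have Nle : (\sum_(p : S * A) Ntab (st h) p.1 p.2 <= change_point (phase t))%N.
      by rewrite -(pair_bigA _ (fun s a => Ntab (st h) s a)) sum_Ntab_le.
    have := potential_ge (phi h) Nle QH.
    have sl : Num.sqrt (phase_log R (phase t)) <= Num.sqrt LT.
      by rewrite ler_wsqrtr // logs_h.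
    have := ler_wpM2l D0 sl; lra.
  rewrite ifN // addr0 in IHh.
  have := mulr_ge0 D0 (sqrtr_ge0 LT); lra.
have := potential_step good_k conc_h ao_max; rewrite -/t -/k.
have := good_cost good_k; rewrite -/k.
have := avg_reward_le_table_floor k.
lra.
Qed.
End PathRegret.

(** * Expected regret *)

Section ExpectedRegret.
Variables (R : realType) (A O S : finType) (A_gt0 : (0 < #|A|)%N).
Variables (S0 : S) (f : S -> A -> O -> S) (r : S -> A -> O -> R).
Hypothesis r01 : forall s a o, 0 <= r s a o <= 1.
Variables (rho : environment R A O).
Local Notation phi := (phi S0 f).
Local Notation st := (state_after S0 f r).
Local Notation prep h := (prepare (st h)).
Local Notation hor := (phase_horizon R).
Local Notation cells := (#|S|%:R * #|A|%:R : R).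
Local Notation agent := (agent_policy S0 f r A_gt0).

Lemma sum_reward n (w : n.-tuple (A * O)) :
  \sum_(i < n) reward S0 f r [::] w i = total_reward S0 f r w.
Proof.
pose u m := total_reward S0 f r (take m w).
transitivity (\sum_(0 <= i < n) (u i.+1 - u i)); last first.
  rewrite telescope_sumr // /u take0 take_oversize ?size_tuple //.
  by rewrite [total_reward _ _ _ [::]]/(0 : R) subr0.
rewrite big_mkord; apply: eq_bigr => i _.
have i_lt : (i < size w)%N by rewrite size_tuple.
rewrite /u (take_nth (tnth w i)) // /total_reward hist_rec_rcons.
by rewrite -tnth_nth addrAC subrr add0r.
Qed.

Lemma agent_greedy n (w : n.-tuple (A * O)) :
  traj_prob rho agent [::] w != 0 -> greedy S0 f r w.
Proof.
move=> pw h1 ao h2 E.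
have lt1 : (size h1 < n)%N.
  by rewrite -(size_tuple w) E size_cat size_rcons addSn ltnS leq_addr.
move: pw; rewrite /traj_prob (bigD1 (Ordinal lt1)) //=.
rewrite (tnth_nth ao) E /= cat_rcons take_size_cat // nth_cat ltnn subnn /=.
rewrite mulf_eq0 negb_or => /andP[+ _]; rewrite mulf_eq0 negb_or => /andP[+ _].
rewrite /agent_policy /= /unif_fun mulf_eq0 negb_or => /andP[+ _].
by rewrite pnatr_eq0 eqb0 negbK -(cur_state_after S0 f r h1).
Qed.

(** Horizons grow at least by the factor [8/7], and the geometric series of ratio [7/8] sums to
    8. *)
Lemma sum_inv_phase_horizon n : \sum_(k < n) (hor k)^-1 <= 8.
Proof.
have hor_geo k : (hor k)^-1 <= (7 / 8) ^+ k.
  elim: k => [|k IHk]; first by rewrite phase_horizon0 invr1 expr0.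
  have H0 : 0 < hor k by exact: lt_le_trans (phase_horizon_ge1 R k).
  have ratio := phase_horizon_ratio R k.
  have H'0 : 0 < hor k.+1 by apply: lt_le_trans ratio; rewrite mulr_gt0.
  apply: (@le_trans _ _ (7 / 8 * (hor k)^-1)); last by rewrite exprS ler_pM2l.
  rewrite -[leRHS]invrK lef_pV2 ?posrE ?invr_gt0 ?mulr_gt0 ?invr_gt0 //.
  by rewrite invfM invrK (_ : (7 / 8)^-1 = 8 / 7) // invf_div.
apply: (@le_trans _ _ (\sum_(k < n) (7 / 8) ^+ k)); first exact: ler_sum.
have := sum_expr_eq (7 / 8 : R) n; have : 0 <= (7 / 8 : R) ^+ n by rewrite exprn_ge0.
lra.
Qed.

Section Reference.
Variables (pi : policy R A O) (tau Dl : R).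
Hypothesis tau1 : 1 <= tau.
Hypothesis pi_tau : policies_within S0 f r rho tau pi.
Hypothesis distortion_le :
  forall tau' : R, tau <= tau' -> distortion S0 f r rho tau' <= Dl.
Local Notation lam := (avg_reward S0 f r rho pi).
Local Notation short_value := (short_value S0 f r rho).
Local Notation value_range := (value_range S0 f r rho pi tau).

Definition phase_failure (k : nat) : history A O -> R :=
  failure_mart S0 f r rho k (short_value k) (value_range k).

Definition failed (T k : nat) (w : history A O) : bool :=
  [exists i : 'I_T.+1, 1 <= phase_failure k (take i w)].

(* A phase whose noise is not concentrated can leave behind entries that are too
   small, but by at most its horizon. *)
Definition path_slack (T : nat) (w : history A O) : R :=
  5 / 3 * tau + 4 +
  \sum_(k < T.+1 | good_phase tau k) hor k * (failed T k w)%:R.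

Lemma path_slack_ge T w : 5 / 3 * tau + 4 <= path_slack T w.
Proof.
rewrite lerDl sumr_ge0 // => k _.
by rewrite mulr_ge0 ?ler0n // (le_trans ler01) ?phase_horizon_ge1.
Qed.

(** A failed phase adds its own horizon to the slack, and so violates [X < hor k]; any other phase
    is covered by [failure_mart_small]. *)
Lemma path_concentrated T (w : T.-tuple (A * O)) :
  always_concentrated S0 f r rho tau (path_slack T w) w.
Proof.
move=> h1 h2 E; rewrite /concentrated; set k := phase (size h1) => good slack s a N0.
have k0 : (0 < k)%N := good_phase_gt0 tau1 good.
have le1 : (size h1 <= T)%N by rewrite -(size_tuple w) E size_cat leq_addr.
have k_lt : (k < T.+1)%N.
  rewrite ltnS (leq_trans _ le1) // ltnW // (leq_trans (ltn_change_point k)) //.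
  rewrite change_point_phase // lt0n; apply/eqP => s0; move: k0.
  by rewrite /k s0 phase0.
have take1 : take (size h1) w = h1 by rewrite E take_size_cat.
apply: (@failure_mart_small R A O S S0 f r rho k (short_value k)
  (value_floor S0 f r rho pi tau k) (value_range k)) => //.
- exact: short_value_bounds.
- exact: concentration_condition.
rewrite ltNge; apply/negP => fail1.
have failk : failed T k w.
  by apply/existsP; exists (Ordinal (le1 : (size h1 < T.+1)%N)); rewrite /= take1.
move: slack; rewrite ltNge => /negP; apply.
rewrite /path_slack (bigD1 (Ordinal k_lt)) //= failk mulr1.
have : 0 <= \sum_(j < T.+1 | good_phase tau j && (j != Ordinal k_lt))
    hor j * (failed T j w)%:R.
  apply: sumr_ge0 => j _.
  by rewrite mulr_ge0 ?ler0n // (le_trans ler01) ?phase_horizon_ge1.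
have := tau1; lra.
Qed.

(** The failure probability is at most 1 and, by Ville's inequality, at most [cells / hor k ^+ 5];
    hence at most [Num.sqrt cells / hor k ^+ 2] in either order of [Num.sqrt cells] and
    [hor k ^+ 2]. *)
Lemma expect_failed T k : good_phase tau k ->
  hor k * expect rho agent [::] (fun w : T.-tuple (A * O) => (failed T k w)%:R) <=
  Num.sqrt cells * (hor k)^-1.
Proof.
move=> good; have k0 := good_phase_gt0 tau1 good.
have H1 := phase_horizon_ge1 R k; have H0 : 0 < hor k by lra.
set p := expect _ _ _ _.
have p1 : p <= 1.
  rewrite -[leRHS](expect_cst rho agent [::] T); apply: expect_le => w _.
  by rewrite lern1 leq_b1.
have pc : p <= cells / hor k ^+ 5.
  rewrite phase_horizon5 -(failure_mart_nil S0 f r rho (short_value k) (value_range k) k0).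
  apply: ville_inequality; first by move=> h; exact: failure_mart_ge0.
  move=> h; apply: failure_mart_super => //.
  exact: (short_value_bounds A_gt0 r01 tau1 pi_tau good).
have C0 : 0 <= cells by rewrite mulr_ge0.
set D := Num.sqrt cells; have D0 : 0 <= D by exact: sqrtr_ge0.
have D2 : cells = D ^+ 2 by rewrite sqr_sqrtr.
suff pD : p <= D / hor k ^+ 2.
  have := ler_wpM2l (ltW H0) pD; rewrite (_ : hor k * (D / _) = D / hor k) //.
  by field; rewrite gt_eqF.
have H2 : 0 < hor k ^+ 2 by rewrite exprn_gt0.
have [DH|HD] := leP (hor k ^+ 2) D.
  by apply: le_trans p1 _; rewrite ler_pdivlMr // mul1r.
apply: le_trans pc _; rewrite D2 ler_pdivrMr ?exprn_gt0 //.
have -> : D / hor k ^+ 2 * hor k ^+ 5 = D * (hor k ^+ 2 * hor k).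
  by field; rewrite gt_eqF.
by rewrite [D ^+ 2]expr2 ler_wpM2l // (le_trans (ltW HD)) // ler_peMr // ltW.
Qed.

Lemma expect_path_slack T :
  expect rho agent [::] (fun w : T.-tuple (A * O) => path_slack T w) <=
  5 / 3 * tau + 4 + 8 * Num.sqrt cells.
Proof.
rewrite /path_slack expectD expect_cst lerD2l expect_sum.
apply: (@le_trans _ _ (\sum_(k < T.+1) Num.sqrt cells * (hor k)^-1)).
  rewrite big_mkcond; apply: ler_sum => k _; case: ifP => good.
    by rewrite expectZ expect_failed.
  by rewrite mulr_ge0 ?sqrtr_ge0 // invr_ge0 (le_trans ler01) ?phase_horizon_ge1.
by rewrite -mulr_sumr mulrC ler_wpM2r ?sqrtr_ge0 // sum_inv_phase_horizon.
Qed.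

(** The pathwise bound [B] is affine in the random slack, so its expectation only involves
    [expect_path_slack]. *)
Lemma expected_regret_le T : (0 < T)%N ->
  expect rho agent [::] (fun w : T.-tuple (A * O) =>
    \sum_(t < T) (lam - reward S0 f r [::] w t)) <=
  (120 * Num.sqrt (cells * ln (2 * T%:R ^+ 2)) + 5 * tau) * T%:R `^ (4 / 5) +
  Dl * T%:R + 17 * cells * T%:R `^ (1 / 5).
Proof.
move=> T0; set LT := ln (2 * T%:R ^+ 2).
set x := T%:R `^ (4 / 5); set y := T%:R `^ (1 / 5).
have T1 : 1 <= T%:R :> R by rewrite ler1n.
have S_gt0 : (0 < #|S|)%N by apply/card_gt0P; exists S0.
have C1 : 1 <= cells by rewrite -natrM ler1n muln_gt0 S_gt0.
have D1 : 1 <= Num.sqrt cells by rewrite -[leLHS]sqrtr1 ler_wsqrtr.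
have logT : 1 / 4 <= LT.
  rewrite -[leLHS]expRK ler_ln ?posrE ?expR_gt0 //; last first.
    by rewrite mulr_gt0 // exprn_gt0 //; lra.
  have e1 := expR_ge1Dx (- (1 / 4) : R); have e0 := expR_gt0 (1 / 4 : R).
  have e2 : expR (- (1 / 4)) * expR (1 / 4) = 1 :> R by rewrite -expRD addNr expR0.
  have : 1 <= T%:R ^+ 2 :> R by rewrite exprn_ege1.
  by have := ler_wpM2r (ltW e0) e1; rewrite e2; lra.
have sl : 1 / 2 <= Num.sqrt LT.
  rewrite -(@ler_pXn2r _ 2) ?nnegrE ?sqrtr_ge0 // sqr_sqrtr; lra.
have logs j : (j <= phase T)%N -> phase_log R j <= LT.
  move=> jT; have cj : (change_point j <= T)%N.
    exact: leq_trans (leq_change_point jT) (change_point_phase T0).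
  have cj0 : 0 < (change_point j)%:R :> R.
    by rewrite ltr0n; exact: leq_ltn_trans (ltn_change_point j).
  have p1 : 0 < 2 * (change_point j)%:R ^+ 2 :> R by rewrite mulr_gt0 // exprn_gt0.
  have p2 : 0 < 2 * T%:R ^+ 2 :> R by rewrite mulr_gt0 // exprn_gt0 // ltr0n.
  by rewrite /phase_log ler_ln ?posrE // ler_pM2l // lerXn2r ?nnegrE ?ler0n // ler_nat.
set k := phase T.
have hk : 0 <= hor k <= y.
  rewrite powR_ge0 ge0_ler_powR ?nnegrE ?ler0n // ler_nat; exact: change_point_phase.
case/andP: hk => h0 hy.
have hx : hor k ^+ 4 <= x by rewrite /x powR_fifth // lerXn2r ?nnegrE ?powR_ge0.
have DL : 0 <= Num.sqrt cells * Num.sqrt LT by rewrite mulr_ge0 ?sqrtr_ge0.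
pose B (X : R) := (63 / 20 + 5 / 2 * tau + 30 * (Num.sqrt cells * Num.sqrt LT)) * x +
  Dl * T%:R + 17 * cells * y + 3 / 2 * x * X.
have path (w : T.-tuple (A * O)) : traj_prob rho agent [::] w != 0 ->
    \sum_(t < T) (lam - reward S0 f r [::] w t) <= B (path_slack T w).
  move=> pw; have sz : size w = T by exact: size_tuple.
  have := @path_regret R A O S A_gt0 S0 f r r01 rho pi tau Dl tau1 pi_tau distortion_le
    (path_slack T w) (path_slack_ge T w) w LT (@path_concentrated T w) (@agent_greedy T w pw).
  rewrite sz -/k -/x => /(_ logs).
  rewrite sumrB sumr_const card_ord sum_reward -[lam *+ T]mulr_natr.
  set pot := if _ then _ else _.
  have pot_ge : - y - 12 * (Num.sqrt cells * Num.sqrt LT) * x <= pot.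
    have DLx : 0 <= 12 * (Num.sqrt cells * Num.sqrt LT) * x.
      by rewrite mulr_ge0 ?powR_ge0 // mulr_ge0.
    rewrite /pot; case: ifP => good; last first.
      have : 0 <= y by exact: powR_ge0.
      lra.
    have k0 : (0 < phase (size w))%N by rewrite sz; exact: good_phase_gt0 good.
    have QH s a : Qtab (st w) s a <= hor k.
      by have := Qtab_state_bounds S0 f r01 w s a; rewrite sz => /andP[_].
    have Nle : (\sum_(p : S * A) Ntab (st w) p.1 p.2 <= change_point k)%N.
      have := sum_Ntab_le S0 f r k0; rewrite sz -/k; apply: leq_trans.
      by rewrite (pair_bigA _ (fun s a => Ntab (st w) s a)).
    clear k0.
    have := @potential_ge R A O S A_gt0 S0 f r rho pi tau Dl (path_slack T w) k
      _ _ (phi w) Nle QH.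
    have sl' : Num.sqrt (phase_log R k) <= Num.sqrt LT by rewrite ler_wsqrtr // logs.
    have DH : 0 <= Num.sqrt cells * hor k ^+ 4 by rewrite mulr_ge0 ?sqrtr_ge0 ?exprn_ge0.
    have := ler_wpM2l DH sl'; have := ler_wpM2l DL hx.
    lra.
  have cy : y <= cells * y by rewrite ler_peMl // powR_ge0.
  have yx : 16 * cells * hor k <= 16 * cells * y by rewrite ler_wpM2l // mulr_ge0 ?mulr_ge0.
  have := ler_wpM2l DL hx; have := C1; rewrite /B /stage_coef /phase_cost.
  lra.
apply: le_trans (expect_le path) _.
rewrite /B expectD expect_cst expectZ.
have x0 : 0 <= 3 / 2 * x by rewrite mulr_ge0 ?powR_ge0.
have := ler_wpM2l x0 (expect_path_slack T).
have -> : Num.sqrt (cells * LT) = Num.sqrt cells * Num.sqrt LT.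
  by rewrite sqrtrM // (le_trans ler01).
(* The multiples of [tau] cancel exactly, and [Num.sqrt LT >= 1/2] lets the logarithmic term
   dominate the rest. *)
have coef : 0 <= (120 * (Num.sqrt cells * Num.sqrt LT) + 5 * tau -
    (63 / 20 + 5 / 2 * tau + 30 * (Num.sqrt cells * Num.sqrt LT)) -
    3 / 2 * (5 / 3 * tau + 4 + 8 * Num.sqrt cells)) * x.
  rewrite mulr_ge0 ?powR_ge0 //.
  have sc : 0 <= Num.sqrt cells by lra.
  have := ler_wpM2l sc sl; lra.
lra.
Qed.
End Reference.
End ExpectedRegret.

Theorem corollary5 (R : realType) (A O S : finType)
    (A_gt0 : (0 < #|A|)%N) (O_gt0 : (0 < #|O|)%N)
    (rho : environment R A O)
    (S0 : S) (f : S -> A -> O -> S) (r : S -> A -> O -> R)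
    (r01 : forall s a o, 0 <= r s a o <= 1)
    (tau : R) (tau_ge1 : 1 <= tau) (T : nat) (T_ge1 : (1 <= T)%N) :
  (regret S0 f r rho (agent_policy S0 f r A_gt0)
     (policies_within S0 f r rho tau) T
   <= ((120 * Num.sqrt (#|S|%:R * #|A|%:R * ln (2 * T%:R ^+ 2)) + 5 * tau)
         * T%:R `^ (4 / 5))%:E
      + 3%:E * sup_distortion S0 f r rho tau * (T%:R)%:E
      + ((54 * #|S|%:R * #|A|%:R + 18 * ln T%:R) * T%:R `^ (1 / 5))%:E
      + (2 * tau ^+ 5)%:E)%E.
Proof.
apply: ge_ereal_sup => _ [pi pi_tau <-].
have dist_sup (tau' : R) : tau <= tau' ->
    ((distortion S0 f r rho tau')%:E <= sup_distortion S0 f r rho tau)%E.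
  by move=> tau'_ge; apply: ereal_sup_ubound; exists tau'.
have dist0 := distortion_ge0 A_gt0 S0 f r01 rho pi tau_ge1.
have T0 : 0 < T%:R :> R by rewrite ltr0n.
case: (sup_distortion S0 f r rho tau) dist_sup => [Dl| |] dist_sup.
- have Dl_ge (tau' : R) : tau <= tau' -> distortion S0 f r rho tau' <= Dl.
    by move/dist_sup; rewrite lee_fin.
  have Dl0 : 0 <= Dl by exact: le_trans dist0 (Dl_ge _ (lexx tau)).
  rewrite -!EFinM -!EFinD lee_fin.
  apply: le_trans (expected_regret_le A_gt0 r01 tau_ge1 pi_tau Dl_ge T_ge1) _.
  have y0 : 0 <= T%:R `^ (1 / 5) :> R by exact: powR_ge0.
  have ln0 : 0 <= ln T%:R * T%:R `^ (1 / 5) :> R by rewrite mulr_ge0 // ln_ge0 // ler1n.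
  have C0 : 0 <= #|S|%:R * #|A|%:R * T%:R `^ (1 / 5) :> R by rewrite !mulr_ge0.
  have DT : 0 <= Dl * T%:R by rewrite mulr_ge0.
  have tau5 : 0 <= tau ^+ 5 by rewrite exprn_ge0 // (le_trans ler01).
  lra.
(* An infinite distortion makes the right side [+oo], as [T] is positive. *)
- have three : (0 < 3%:E :> \bar R)%E by rewrite lte_fin.
  by rewrite gt0_muley // gt0_mulye ?lte_fin // addeC /= leey.
- by have := dist_sup tau (lexx tau); rewrite leeNy_eq.
Qed.
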